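(* Let $p_1,p_2,q$ be distinct primes with $p_1\equiv p_2\equiv -q\equiv1\pmod 4$, $k=\mathbb{Q}(\sqrt{p_1p_2q},i)$, $\mathbb{K}_3=k(\sqrt q)$, and $\epsilon_{p_1p_2q}=x+y\sqrt{p_1p_2q}$ with $x,y\in\mathbb{Z}$. Assume $N(\epsilon_{p_1p_2})=-1$. 1. If $q(x\pm1)$ or $2q(x\pm1)$ is a square in $\mathbb{N}$, then $\kappa_{\mathbb{K}_3}=\langle[\mathcal H_1\mathcal H_3]\rangle$ or $\kappa_{\mathbb{K}_3}=\langle[\mathcal H_1\mathcal H_4]\rangle$. 2. If $x\pm1$ is a square in $\mathbb{N}$, then $\kappa_{\mathbb{K}_3}=\langle[\mathcal H_1\mathcal H_3],[\mathcal H_2\mathcal H_4]\rangle$ or $\kappa_{\mathbb{K}_3}=\langle[\mathcal H_1\mathcal H_4],[\mathcal H_2\mathcal H_3]\rangle$. 3. If $p_1(x\pm1)$ or $2p_1(x\pm1)$ is a square in $\mathbb{N}$, then $\kappa_{\mathbb{K}_3}=\langle[\mathcal H_1\mathcal H_3],[\mathcal H_1\mathcal H_4]\rangle$. 4. If $p_2(x\pm1)$ or $2p_2(x\pm1)$ is a square in $\mathbb{N}$, then $\kappa_{\mathbb{K}_3}=\langle[\mathcal H_1\mathcal H_3],[\mathcal H_2\mathcal H_3]\rangle$.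
   Context: $i=\sqrt{-1}$; $\epsilon_m>1$ is the fundamental unit of $\mathbb{Q}(\sqrt m)$ and $N(\epsilon_m)$ its norm to $\mathbb{Q}$. For integers $c,u$, ''$c(u\pm1)$ is a square in $\mathbb{N}$'' means at least one of $c(u+1)$, $c(u-1)$ is the square of a natural number. Write $p_1=e^2+4f^2$, $p_2=g^2+4h^2$ ($e,f,g,h\in\mathbb{N}$), $\pi_1=e+2if$, $\pi_2=e-2if$, $\pi_3=g+2ih$, $\pi_4=g-2ih$; $\mathcal H_j$ is the prime ideal of $k$ above $\pi_j$ and $[\cdot]$ denotes ideal class in $k$. $\kappa_{\mathbb{K}_3}$ is the kernel of the map $\mathrm{Cl}(k)\to\mathrm{Cl}(\mathbb{K}_3)$ induced by extension of ideals. *)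

(* Defs.v *)
From HB Require Export structures.
From mathcomp Require Export all_boot all_order all_algebra all_field.
From mathcomp Require Export all_classical.

#[export] Set Implicit Arguments.
#[export] Unset Strict Implicit.
#[export] Unset Printing Implicit Defensive.

Export Order.TTheory GRing.Theory Num.Theory.

#[global] Open Scope classical_set_scope.
#[global] Open Scope ring_scope.

(* Number fields are realised as subfields of algC.
   0 is covered by 1 - 1, and closure under inverses by 1 / y (0^-1 = 0). *)
Definition is_subfield (F : set algC) : Prop :=
  [/\ F 1,
      (forall x y, F x -> F y -> F (x - y)) &
      (forall x y, F x -> F y -> F (x / y))].

(* F(S); when F is empty this is Q(S), the prime field of algC being Q. *)
Definition adjoin (F S : set algC) : set algC := smallest is_subfield (F `|` S).

Definition Qadjoin (S : set algC) : set algC := adjoin set0 S.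

Definition ringint (F : set algC) : set algC := [set z | F z /\ z \in Aint].

Definition is_ideal (F I : set algC) : Prop :=
  [/\ I `<=` ringint F,
      I 0,
      (forall x y, I x -> I y -> I (x + y)) &
      (forall a x, ringint F a -> I x -> I (a * x))].

Definition is_nzideal (F I : set algC) : Prop :=
  is_ideal F I /\ exists2 x, I x & x != 0.

Definition is_prime_ideal (F P : set algC) : Prop :=
  [/\ is_ideal F P,
      ~ P 1 &
      forall x y, ringint F x -> ringint F y -> P (x * y) -> P x \/ P y].

Definition scale (a : algC) (I : set algC) : set algC := [set a * x | x in I].

Definition idealM (I J : set algC) : set algC :=
  [set z | exists n (x y : 'I_n -> algC),
     [/\ forall i, I (x i), forall i, J (y i) & z = \sum_(i < n) x i * y i]].

Definition ideal_ext (K I : set algC) : set algC := idealM I (ringint K).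

Definition prime_above (F K : set algC) (a : algC) (P : set algC) : Prop :=
  is_prime_ideal K P /\ P `&` ringint F = scale a (ringint F).

(* Ideal classes are equivalence classes of nonzero integral ideals, I and J
   being equivalent when a I = b J for some nonzero integers a, b of F; the
   class group Cl F is the set of these classes.                             *)
Definition ideal_class (F I : set algC) : set (set algC) :=
  [set J | is_nzideal F J /\
     exists a b, [/\ ringint F a, ringint F b, a != 0, b != 0 &
                     scale a I = scale b J]].

Definition Cl (F : set algC) : set (set (set algC)) :=
  [set C | exists2 I, is_nzideal F I & C = ideal_class F I].

Definition class1 (F : set algC) : set (set algC) := ideal_class F (ringint F).

Definition classM (F : set algC) (C D : set (set algC)) : set (set algC) :=
  [set L | exists I J, [/\ C I, D J & ideal_class F (idealM I J) L]].

Definition is_Cl_subgroup (F : set algC) (G : set (set (set algC))) : Prop :=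
  [/\ G `<=` Cl F,
      G (class1 F),
      (forall C D, G C -> G D -> G (classM F C D)) &
      (forall C D, G C -> Cl F D -> classM F C D = class1 F -> G D)].

Definition Cl_gen (F : set algC) (S : set (set (set algC))) :
    set (set (set algC)) :=
  smallest (is_Cl_subgroup F) S.

Definition class_ext (K : set algC) (C : set (set algC)) : set (set algC) :=
  [set L | exists2 I, C I & ideal_class K (ideal_ext K I) L].

Definition capitulation (F K : set algC) : set (set (set algC)) :=
  [set C | Cl F C /\ class_ext K C = class1 K].

Definition is_unit (F : set algC) (u : algC) : Prop :=
  [/\ ringint F u, u != 0 & ringint F u^-1].

Definition quadfield (m : nat) : set algC := Qadjoin [set sqrtC m%:R].

(* The order on algC is partial: 1 < eps entails that eps is real. *)
Definition is_fundamental_unit (m : nat) (eps : algC) : Prop :=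
  [/\ is_unit (quadfield m) eps,
      1 < eps &
      forall u, is_unit (quadfield m) u ->
        exists n : int, u = eps ^ n \/ u = - eps ^ n].

(* N(a + b sqrt m) = a^2 - m b^2; the value is unique when m is not a square. *)
Definition has_quad_norm (m : nat) (z : algC) (r : rat) : Prop :=
  exists a b : rat,
    z = ratr a + ratr b * sqrtC m%:R /\ r = a ^+ 2 - m%:R * b ^+ 2.

Definition is_square_pm1 (c u : int) : Prop :=
  exists n : nat, c * (u + 1) = (n%:Z) ^+ 2 \/ c * (u - 1) = (n%:Z) ^+ 2.

(* Main.v *)
Require Import Defs.
From mathcomp Require Import ring zify.

(* Write P = p1 p2 and d = P q, and let sigma generate Gal(K3 / k).  If an ideal I
   of k becomes principal in K3, generated by alpha, then I^2 is generated by the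
   norm c of alpha, and alpha^2 = c eta for the unit eta = alpha / sigma(alpha) of
   relative norm 1.  Norms to the quadratic subfields show that, up to powers of i
   and squares of K3, such an eta is a power of eps_P: the roots of unity are
   controlled by the imaginary quadratic subfields, every unit of Q(sqrt q) is +-1
   or +-2 times a square, sqrt 2 is not in K3, and 2 = i^3 (1 + i)^2.

   If w w' = n^2 then (w + n)^2 = w (w + w' + 2 n).  Since eps_P has norm -1 = i^2,
   this makes eps_P, up to squares, a Gaussian integer u + 2 i, where
   u^2 + 4 = P v^2; then (u + 2 i) pi1 pi3 has norm (P v)^2 and the same identity
   shows that eps_P pi1 pi3 or eps_P pi1 pi4 is a square in K3 up to a power of i.
   As an ideal whose square is principal is determined by a generator of its square,
   kappa is generated by [H1 H3] and [H2 H4], or by [H1 H4] and [H2 H3], whatever x.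

   Finally the identity gives 2 (x +- 1) eps_d = (x +- 1 + y sqrt d)^2, so each
   condition on x +- 1 makes q, p1 or p2 a square in k up to a unit; hence
   [H1 H3] = [H2 H4] and [H1 H4] = [H2 H3], or [H1] = [H2], or [H3] = [H4]. *)

(** * Subfields generated by square roots *)

Lemma subfield_divringClosed (F : set algC) : is_subfield F ->
  exists S : divringClosed algC, forall z, F z <-> z \in S.
Proof.
case=> F1 FB FV.
have closedF : GRing.divring_closed (mem F).
  by split=> [|x y|x y]; rewrite !inE; [|apply: FB|apply: FV].
pose divringF := GRing.isDivringClosed.Build algC (mem F) closedF.
pose S : divringClosed algC := HB.pack (mem F : {pred algC}) divringF.
by exists S => z; split=> Fz; [have := mem_set Fz | apply: set_mem].
Qed.

Section SubfieldClosure.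

Variable F : set algC.
Hypothesis sF : is_subfield F.

Let S : exists S : divringClosed algC, forall z, F z <-> z \in S.
Proof. exact: subfield_divringClosed. Qed.

Lemma subfield0 : F 0.
Proof. by have [T ->] := S; apply: rpred0. Qed.

Lemma subfield1 : F 1.
Proof. by have [T ->] := S; apply: rpred1. Qed.

Lemma subfieldN x : F x -> F (- x).
Proof. by have [T FT] := S; rewrite !FT rpredN. Qed.

Lemma subfieldD x y : F x -> F y -> F (x + y).
Proof. by have [T FT] := S; rewrite !FT; apply: rpredD. Qed.

Lemma subfieldB x y : F x -> F y -> F (x - y).
Proof. by have [T FT] := S; rewrite !FT; apply: rpredB. Qed.

Lemma subfieldV x : F x -> F x^-1.
Proof. by have [T FT] := S; rewrite !FT rpredV. Qed.

Lemma subfieldM x y : F x -> F y -> F (x * y).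
Proof. by have [T FT] := S; rewrite !FT; apply: rpredM. Qed.

Lemma subfieldX n x : F x -> F (x ^+ n).
Proof. by have [T FT] := S; rewrite !FT; apply: rpredX. Qed.

Lemma subfieldXz n x : F x -> F (x ^ n).
Proof. by have [T FT] := S; rewrite !FT; apply: rpredXz. Qed.

Lemma subfield_nat n : F n%:R.
Proof. by have [T ->] := S; apply: rpred_nat. Qed.

Lemma subfield_int n : F n%:~R.
Proof. by have [T ->] := S; apply: rpred_int. Qed.

Lemma subfield_Crat z : z \in Crat -> F z.
Proof. by have [T ->] := S; apply: rpred_Crat. Qed.

Lemma subfield_sum n (z : 'I_n -> algC) : (forall i, F (z i)) -> F (\sum_i z i).
Proof.
by have [T FT] := S => Fz; rewrite FT; apply: rpred_sum => i _; apply/FT.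
Qed.

End SubfieldClosure.

Ltac in_subfield := repeat match goal with
  | sF : is_subfield ?F |- ?F _ => first
    [ assumption | exact (subfield1 sF) | exact (subfield0 sF)
    | exact (subfield_nat sF _) | exact (subfield_int sF _)
    | refine (subfieldX sF _ _) | refine (subfieldD sF _ _)
    | refine (subfieldB sF _ _) | refine (subfieldN sF _)
    | refine (subfieldM sF _ _) | refine (subfieldV sF _)
    | refine (subfieldXz sF _ _) | apply: (subfield_Crat sF); assumption ]
  end.

Lemma rmorph_preim_subfield F (nu : {rmorphism algC -> algC}) :
  is_subfield F -> is_subfield [set z | F (nu z)].
Proof.
move=> sF; split=> /=; first by rewrite rmorph1; in_subfield.
  by move=> x y ? ?; rewrite rmorphB; in_subfield.
by move=> x y ? ?; rewrite fmorph_div; in_subfield.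
Qed.

Lemma rmorph_eq_subfield (f g : {rmorphism algC -> algC}) :
  is_subfield [set z | f z = g z].
Proof.
split=> /=; first by rewrite !rmorph1.
  by move=> x y fx fy; rewrite !rmorphB fx fy.
by move=> x y fx fy; rewrite !fmorph_div fx fy.
Qed.

Lemma adjoin_subfield F S : is_subfield (adjoin F S).
Proof.
split; first by move=> G [[]].
  by move=> x y Fx Fy G GP; apply: subfieldB; [case: GP | apply: Fx | apply: Fy].
move=> x y Fx Fy G GP; have [sG _] := GP.
by have := Fx G GP; have := Fy G GP => ? ?; in_subfield.
Qed.

Lemma sub_adjoin F S : F `<=` adjoin F S.
Proof. by move=> x Fx G [_]; apply; left. Qed.

Lemma adjoin_gen F S : S `<=` adjoin F S.
Proof. by move=> x Sx G [_]; apply; right. Qed.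

Lemma adjoin_min F S G :
  is_subfield G -> F `<=` G -> S `<=` G -> adjoin F S `<=` G.
Proof. by move=> sG FG SG x; apply; split=> // y [/FG|/SG]. Qed.

Lemma adjoin_adjoin F S T : adjoin (adjoin F S) T = adjoin F (S `|` T).
Proof.
apply/seteqP; split; apply: adjoin_min; try exact: adjoin_subfield.
- apply: adjoin_min; first exact: adjoin_subfield.
    exact: sub_adjoin.
  by move=> z Sz; apply: adjoin_gen; left.
- by move=> z Tz; apply: adjoin_gen; right.
- by move=> z Fz; do 2!apply: sub_adjoin.
- by move=> z [Sz|Tz]; [apply: sub_adjoin; apply: adjoin_gen | apply: adjoin_gen].
Qed.

Lemma adjoin_rmorph_id F S (nu : {rmorphism algC -> algC}) :
    (forall z, F z -> nu z = z) -> (forall z, S z -> nu z = z) ->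
  forall z, adjoin F S z -> nu z = z.
Proof. exact: (adjoin_min (rmorph_eq_subfield nu idfun)). Qed.

Lemma Qadjoin_subfield S : is_subfield (Qadjoin S).
Proof. exact: adjoin_subfield. Qed.

Lemma Qadjoin_gen S : S `<=` Qadjoin S.
Proof. exact: adjoin_gen. Qed.

Lemma Qadjoin_min S G : is_subfield G -> S `<=` G -> Qadjoin S `<=` G.
Proof. by move=> sG SG; apply: adjoin_min => // z []. Qed.

Lemma Qadjoin_rmorph_eq S (f g : {rmorphism algC -> algC}) :
  (forall z, S z -> f z = g z) -> forall z, Qadjoin S z -> f z = g z.
Proof. exact: (Qadjoin_min (rmorph_eq_subfield f g)). Qed.

Lemma Crat_subfield : is_subfield [set` Crat].
Proof.
by split=> [|x y|x y]; rewrite /= ?rpred1 //; [apply: rpredB | apply: rpred_div].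
Qed.

Lemma QadjoinE S : Qadjoin S = adjoin [set` Crat] S.
Proof.
apply/seteqP; split; apply: adjoin_min; try exact: adjoin_subfield.
- by [].
- exact: adjoin_gen.
- by move=> z; apply: subfield_Crat; apply: adjoin_subfield.
- exact: adjoin_gen.
Qed.

Lemma adjoin_sqrtP F s z : is_subfield F -> F (s ^+ 2) ->
  adjoin F [set s] z <-> exists a b, [/\ F a, F b & z = a + b * s].
Proof.
move=> sF Fs2; pose E : set algC := [set w | exists a b, [/\ F a, F b & w = a + b * s]].
have FE : F `<=` E.
  by move=> w Fw; exists w, 0; split; rewrite ?mul0r ?addr0 //; in_subfield.
have closedM x y : E x -> E y -> E (x * y).
  move=> [a [b [Fa Fb ->]]] [c [e [Fc Fe ->]]].
  exists (a * c + b * e * s ^+ 2), (a * e + b * c).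
  by split; in_subfield; ring.
have closedV x : E x -> E x^-1.
  move=> [a [b [Fa Fb ->]]]; have [n0|nN0] := eqVneq ((a + b * s) * (a - b * s)) 0.
    apply: FE; move/eqP: n0; rewrite mulf_eq0 subr_eq0 => /orP[/eqP-> | /eqP <-].
      by in_subfield.
    by in_subfield.
  exists (a / (a ^+ 2 - b ^+ 2 * s ^+ 2)), (- b / (a ^+ 2 - b ^+ 2 * s ^+ 2)).
  split; try by in_subfield.
  have -> : a ^+ 2 - b ^+ 2 * s ^+ 2 = (a + b * s) * (a - b * s) by ring.
  by move: nN0; rewrite mulf_eq0 negb_or => /andP[? ?]; field; apply/andP.
have sE : is_subfield E.
  split=> [|x y|x y Ex Ey]; first by apply: FE; in_subfield.
    move=> [a [b [Fa Fb ->]]] [c [e [Fc Fe ->]]]; exists (a - c), (b - e).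
    by split; in_subfield; ring.
  by apply: closedM => //; apply: closedV.
split=> [|[a [b [Fa Fb ->]]]].
  move: z; apply: adjoin_min => // _ ->.
  by exists 0, 1; split; rewrite ?mul1r ?add0r //; in_subfield.
have sG := adjoin_subfield F [set s].
by in_subfield; [apply: sub_adjoin | apply: sub_adjoin | apply: adjoin_gen].
Qed.

Lemma Qadjoin_sqrtP s z : s ^+ 2 \in Crat ->
  Qadjoin [set s] z <-> exists a b, [/\ a \in Crat, b \in Crat & z = a + b * s].
Proof. by move=> s2; rewrite QadjoinE; apply: adjoin_sqrtP => //; apply: Crat_subfield. Qed.

Lemma adjoin_sqr_cases F s z : is_subfield F -> F (s ^+ 2) ->
  adjoin F [set s] z -> F (z ^+ 2) -> F z \/ F (z * s).
Proof.
move=> sF Fs2 /adjoin_sqrtP-/(_ sF Fs2)[a [b [Fa Fb ->]]] Fz2.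
have [->|aN0] := eqVneq a 0.
  by right; rewrite add0r -mulrA -expr2; in_subfield.
have [->|bN0] := eqVneq b 0; first by left; rewrite mul0r addr0.
suff Fs : F s by left; in_subfield.
have -> : s = ((a + b * s) ^+ 2 - a ^+ 2 - b ^+ 2 * s ^+ 2) / (2 * a * b).
  by field; rewrite aN0 bN0.
by in_subfield.
Qed.

(** * Automorphisms *)

Definition is_quad_conj (F K : set algC) (sg : {rmorphism algC -> algC}) : Prop :=
  [/\ forall z, F z -> sg z = z,
      forall z, K z -> K (sg z),
      forall z, K z -> sg (sg z) = z &
      forall z, K z -> sg z = z -> F z].

Lemma adjoin_sqrt_quad_conj F s (sg : {rmorphism algC -> algC}) :
    is_subfield F -> F (s ^+ 2) -> (forall z, F z -> sg z = z) -> sg s = - s ->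
  is_quad_conj F (adjoin F [set s]) sg.
Proof.
move=> sF Fs2 fixF sgs.
have sgE a b : F a -> F b -> sg (a + b * s) = a - b * s.
  by move=> Fa Fb; rewrite rmorphD rmorphM sgs !fixF // mulrN.
split=> // z /adjoin_sqrtP-/(_ sF Fs2)[a [b [Fa Fb ->]]].
- rewrite sgE //; apply/adjoin_sqrtP => //; exists a, (- b).
  by rewrite mulNr; split; in_subfield.
- by rewrite sgE // -mulNr sgE ?mulNr ?opprK //; in_subfield.
- rewrite sgE // => /addrI/esym/eqP.
  by rewrite -addr_eq0 -mulr2n mulrn_eq0 => /eqP->; rewrite addr0.
Qed.

Lemma rmorph_sqrt_Crat (nu : {rmorphism algC -> algC}) s :
  s ^+ 2 \in Crat -> nu s = s \/ nu s = - s.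
Proof.
move=> s2; have /eqP : nu s ^+ 2 = s ^+ 2 by rewrite -rmorphXn aut_Crat.
by rewrite eqf_sqr => /orP[]/eqP; [left | right].
Qed.

Section Multiquadratic.

Variable S : set algC.
Hypothesis sqrS : forall s, S s -> s ^+ 2 \in Crat.

Lemma multiquadratic_aut (nu : {rmorphism algC -> algC}) z :
  Qadjoin S z -> Qadjoin S (nu z).
Proof.
have sK := Qadjoin_subfield S; move: z; apply: Qadjoin_min => [|s Ss /=].
  exact: rmorph_preim_subfield.
by have [->|->] := rmorph_sqrt_Crat nu (sqrS Ss); in_subfield; apply: Qadjoin_gen.
Qed.

Lemma multiquadratic_autK (nu : {rmorphism algC -> algC}) z :
  Qadjoin S z -> nu (nu z) = z.
Proof.
apply: (Qadjoin_rmorph_eq (f := (nu \o nu)%FUN) (g := idfun)) => s Ss /=.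
by have [nuE|nuE] := rmorph_sqrt_Crat nu (sqrS Ss); rewrite !nuE // rmorphN nuE opprK.
Qed.

Lemma multiquadratic_autC (nu mu : {rmorphism algC -> algC}) z :
  Qadjoin S z -> nu (mu z) = mu (nu z).
Proof.
apply: (Qadjoin_rmorph_eq (f := (nu \o mu)%FUN) (g := (mu \o nu)%FUN)) => s Ss /=.
have [nuE|nuE] := rmorph_sqrt_Crat nu (sqrS Ss);
  by have [muE|muE] := rmorph_sqrt_Crat mu (sqrS Ss); rewrite !(nuE, muE, rmorphN).
Qed.

End Multiquadratic.

Lemma minPoly_sqrt (L : fieldExtType rat) (E : {subfield L}) (c : L) :
  c \notin E -> c ^+ 2 \in E -> minPoly E c = 'X^2 - (c ^+ 2)%:P.
Proof.
move=> nEc Ec2; have monic2 : 'X^2 - (c ^+ 2)%:P \is monic by apply: monicXnsubC.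
have dvd2 : minPoly E c %| 'X^2 - (c ^+ 2)%:P.
  apply: minPoly_dvdp; last by rewrite rootE !hornerE subrr.
  by rewrite rpredB ?rpredX ?polyOverX // polyOverC.
apply/eqP; rewrite -eqp_monic ?monic_minPoly // -dvdp_size_eqp //.
rewrite eqn_leq dvdp_leq ?monic_neq0 //= size_XnsubC // size_minPoly.
by move: nEc; rewrite -adjoin_deg_eq1 /adjoin_degree; case: (_.-1).
Qed.

Lemma num_field_adjoin_sub (L : fieldExtType rat) (LC : {rmorphism L -> algC})
    (F : set algC) (r : seq L) : is_subfield F ->
  {in r, forall x, F (LC x)} -> {in <<1 & r>>%AS, forall x, F (LC x)}.
Proof.
move=> sF; elim/last_ind: r => [_ z|r x IHr rF z].
  rewrite /= Fadjoin_nil => /vlineP[a ->].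
  by rewrite alg_num_field fmorph_rat; apply: subfield_Crat; rewrite ?Crat_rat.
rewrite /= adjoin_rcons => /Fadjoin_polyP[p /polyOverP rp ->].
rewrite -horner_map horner_coef; apply: subfield_sum => // i; in_subfield.
  by rewrite coef_map; apply: IHr => // y ry; apply: rF; rewrite mem_rcons inE ry orbT.
by apply: rF; rewrite mem_rcons mem_head.
Qed.

Lemma exists_aut_opp (s : seq algC) (c : algC) :
    c ^+ 2 \in Crat -> ~ Qadjoin [set` s] c ->
  exists nu : {rmorphism algC -> algC}, {in s, forall x, nu x = x} /\ nu c = - c.
Proof.
move=> /CratP[m c2] nFc.
have [L [LC [[|d r] // [Dd Ds] genL]]] := num_field_exists (c :: s).
pose E := <<1 & r>>%AS.
have nEd : d \notin E.
  apply/negP => /(num_field_adjoin_sub (Qadjoin_subfield [set` s])) Fd.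
  apply: nFc; rewrite -Dd; apply: Fd => x rx; apply: Qadjoin_gen.
  by rewrite /= -Ds map_f.
have Ed2 : d ^+ 2 \in E.
  have -> : d ^+ 2 = m%:A.
    by apply: (fmorph_inj LC); rewrite rmorphXn Dd c2 alg_num_field fmorph_rat.
  by rewrite memvZ // mem1v.
pose phi := kHomExtend E \1 d (- d).
have homE1 : kHom E E (\1%VF : 'End(L)) by rewrite kHom1.
have rootN : root (map_poly \1%VF (minPoly E d)) (- d).
  by rewrite lfun1_poly minPoly_sqrt // rootE !hornerE sqrrN subrr.
have phi_monoid : monoid_morphism phi.
  apply/kHom_monoid_morphism; rewrite -genL.
  have -> : <<1 & d :: r>>%VS = <<E; d>>%VS.
    rewrite -adjoin_rcons; apply: subv_anti.
    by rewrite !adjoin_seqSr // => x; rewrite mem_rcons.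
  by apply: (kHomSl (sub1v E)); apply: kHomExtendP.
pose phi_isMonoid := GRing.isMonoidMorphism.Build _ _ phi phi_monoid.
pose phiM : {rmorphism _ -> _} := HB.pack (fun_of_lfun phi) phi_isMonoid.
have [nu Dnu] := extend_algC_subfield_aut LC phiM.
exists nu; split=> [x|].
  rewrite -Ds => /mapP[z rz ->]; rewrite -Dnu /= (kHomExtend_id _ _ _) ?id_lfunE //.
  exact: seqv_sub_adjoin.
by rewrite -Dd -Dnu /= (kHomExtend_val homE1 rootN) rmorphN.
Qed.

(** * Ideals and ideal classes *)

Lemma Aint_sqr (z : algC) : z ^+ 2 \in Aint -> z \in Aint.
Proof.
move=> z2; pose p := minCpoly (z ^+ 2).
have pZ : p \is a polyOver Num.int by move: z2; rewrite unfold_in.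
have [p0 [Dp mon_p] _] := minCpolyP (z ^+ 2).
apply: (@root_monic_Aint (p \Po 'X^2)).
- by apply/rootP; rewrite horner_comp hornerXn; apply/rootP; apply: root_minCpoly.
- rewrite monicE lead_coef_comp ?size_polyXn //.
  by rewrite /p Dp lead_coef_map (monicP mon_p) lead_coefXn rmorph1 expr1n mulr1.
- by apply: polyOver_comp => //; rewrite rpredX ?polyOverX.
Qed.

Lemma Aint_i : ('i : algC) \in Aint.
Proof. by apply: Aint_sqr; rewrite sqrCi rpredN rpred1. Qed.

Lemma ringint_sqr F (z : algC) : F z -> z ^+ 2 \in Aint -> ringint F z.
Proof. by move=> Fz /Aint_sqr. Qed.

Lemma ringint_sub (F K : set algC) : F `<=` K -> ringint F `<=` ringint K.
Proof. by move=> FK x [/FK]. Qed.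

Section RingOfIntegers.

Variable F : set algC.
Hypothesis sF : is_subfield F.

Lemma ringintD x y : ringint F x -> ringint F y -> ringint F (x + y).
Proof. by move=> [? ?] [? ?]; split; [in_subfield | rewrite rpredD]. Qed.

Lemma ringintB x y : ringint F x -> ringint F y -> ringint F (x - y).
Proof. by move=> [? ?] [? ?]; split; [in_subfield | rewrite rpredB]. Qed.

Lemma ringintM x y : ringint F x -> ringint F y -> ringint F (x * y).
Proof. by move=> [? ?] [? ?]; split; [in_subfield | rewrite rpredM]. Qed.

Lemma ringint_int n : ringint F n%:~R.
Proof. by split; [in_subfield | rewrite Aint_int]. Qed.

Lemma ringint_nat n : ringint F n%:R.
Proof. exact: (ringint_int n). Qed.

Lemma ringint1 : ringint F 1.
Proof. exact: (ringint_nat 1). Qed.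

Lemma ringint0 : ringint F 0.
Proof. exact: (ringint_nat 0). Qed.

End RingOfIntegers.

Ltac in_ringint := repeat match goal with
  | sF : is_subfield ?F |- ringint ?F _ => first
    [ assumption | exact (ringint1 sF) | exact (ringint0 sF)
    | exact (ringint_nat sF _) | exact (ringint_int sF _)
    | refine (ringintB sF _ _) | refine (ringintD sF _ _)
    | refine (ringintM sF _ _) ]
  end.

Lemma ideal0 F I : is_ideal F I -> I 0. Proof. by case. Qed.

Lemma idealD F I (x y : algC) : is_ideal F I -> I x -> I y -> I (x + y).
Proof. by case=> _ _ ID _; apply: ID. Qed.

Lemma ideal_mul F I (a x : algC) : is_ideal F I -> ringint F a -> I x -> I (a * x).
Proof. by case=> _ _ _ IM; apply: IM. Qed.

Lemma ideal_ringint F I (x : algC) : is_ideal F I -> I x -> ringint F x.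
Proof. by case=> IO _ _ _; apply: IO. Qed.

Lemma ringint_ideal F : is_subfield F -> is_ideal F (ringint F).
Proof. by move=> sF; split=> // *; in_ringint. Qed.

Lemma ringint_nzideal F : is_subfield F -> is_nzideal F (ringint F).
Proof.
move=> sF; split; first exact: ringint_ideal.
by exists 1; [in_ringint | rewrite oner_eq0].
Qed.

Lemma mem_idealM I J (x y : algC) : I x -> J y -> idealM I J (x * y).
Proof.
move=> Ix Jy; exists 1%N, (fun=> x), (fun=> y).
by split=> //; rewrite big_ord1.
Qed.

Lemma idealM0 I J : idealM I J 0.
Proof. by exists 0%N, (fun=> 0), (fun=> 0); split; rewrite ?big_ord0 //; case. Qed.

Lemma idealMD I J (x y : algC) :
  idealM I J x -> idealM I J y -> idealM I J (x + y).
Proof.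
move=> [m [a [b [Ia Jb ->]]]] [n [c [e [Ic Je ->]]]].
exists (m + n)%N.
exists (fun i => match fintype.split i with inl j => a j | inr j => c j end).
exists (fun i => match fintype.split i with inl j => b j | inr j => e j end).
split; try by move=> i; case: (fintype.split i).
rewrite big_split_ord /=; congr (_ + _); apply: eq_bigr => i _.
  by rewrite (unsplitK (inl i)).
by rewrite (unsplitK (inr i)).
Qed.

Lemma idealM_min I J (S : set algC) :
    S 0 -> (forall x y, S x -> S y -> S (x + y)) ->
    (forall x y, I x -> J y -> S (x * y)) ->
  idealM I J `<=` S.
Proof.
by move=> S0 SD SM _ [n [x [y [Ix Jy ->]]]]; elim/big_ind: _ => // i _; apply: SM.
Qed.

Lemma idealM_min_ideal F I J L : is_ideal F L ->
  (forall x y, I x -> J y -> L (x * y)) -> idealM I J `<=` L.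
Proof.
by move=> iL; apply: idealM_min; [apply: ideal0 iL | move=> *; apply: (idealD iL)].
Qed.

Lemma idealMC I J : idealM I J = idealM J I.
Proof.
apply/seteqP; split; apply: idealM_min; try exact: idealM0;
  by [move=> x y; apply: idealMD | move=> x y ? ?; rewrite mulrC; apply: mem_idealM].
Qed.

Lemma idealMA I J L : idealM I (idealM J L) = idealM (idealM I J) L.
Proof.
have subA I' J' L' : idealM (idealM I' J') L' `<=` idealM I' (idealM J' L').
  apply: idealM_min => [|x y|x z xIJ Lz]; [exact: idealM0 | exact: idealMD |].
  move: x xIJ; apply: idealM_min => [|x y|x y Ix Jy].
  - by rewrite mul0r; apply: idealM0.
  - by rewrite mulrDl; apply: idealMD.
  - by rewrite -mulrA; do 2!apply: mem_idealM => //.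
apply/seteqP; split; last exact: subA.
by rewrite idealMC [X in idealM X I]idealMC (idealMC _ L) (idealMC I J); apply: subA.
Qed.

Lemma idealMACA I J L M :
  idealM (idealM I J) (idealM L M) = idealM (idealM I L) (idealM J M).
Proof. by rewrite -!idealMA; congr idealM; rewrite !idealMA (idealMC J). Qed.

Lemma mem_scale (a x : algC) I : I x -> scale a I (a * x).
Proof. by move=> Ix; exists x. Qed.

Lemma scale_scale (a b : algC) I : scale a (scale b I) = scale (a * b) I.
Proof.
apply/seteqP; split=> [_ [_ [x Ix <-] <-]|_ [x Ix <-]].
  by rewrite mulrA; apply: mem_scale.
by rewrite -mulrA; do 2!apply: mem_scale.
Qed.

Lemma scale1 I : scale 1 I = I.
Proof.
apply/seteqP; split=> [_ [x Ix <-]|x Ix]; first by rewrite mul1r.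
by exists x; rewrite ?mul1r.
Qed.

Lemma scaleI (a : algC) I J : a != 0 -> scale a I = scale a J -> I = J.
Proof.
move=> aN0 /(congr1 (scale a^-1)); rewrite !scale_scale mulVf //.
by rewrite !scale1.
Qed.

Lemma scale_idealM (a : algC) I J : scale a (idealM I J) = idealM (scale a I) J.
Proof.
apply/seteqP; split=> [_ [z zIJ <-]|].
  move: z zIJ; apply: idealM_min => [|x y|x y Ix Jy].
  - by rewrite mulr0; apply: idealM0.
  - by rewrite mulrDr; apply: idealMD.
  - by rewrite mulrA; apply: mem_idealM => //; apply: mem_scale.
apply: idealM_min => [|_ _ [x xIJ <-] [y yIJ <-]|_ y [x Ix <-] Jy].
- by exists 0; [apply: idealM0 | rewrite mulr0].
- by rewrite -mulrDr; apply: mem_scale; apply: idealMD.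
- by rewrite -mulrA; apply: mem_scale; apply: mem_idealM.
Qed.

Lemma idealM_scale (a b : algC) I J :
  idealM (scale a I) (scale b J) = scale (a * b) (idealM I J).
Proof.
by rewrite -scale_idealM idealMC -scale_idealM scale_scale (idealMC J).
Qed.

Section Ideals.

Variable F : set algC.
Hypothesis sF : is_subfield F.

Lemma idealM_ideal I J : is_ideal F I -> is_ideal F J -> is_ideal F (idealM I J).
Proof.
move=> iI iJ; split; [|exact: idealM0|by move=> x y; apply: idealMD|].
  apply: (idealM_min_ideal (ringint_ideal sF)) => x y /(ideal_ringint iI) ?.
  by move=> /(ideal_ringint iJ) ?; in_ringint.
move=> a z Oa; move: z; apply: idealM_min => [|x y|x y Ix Jy].
- by rewrite mulr0; apply: idealM0.
- by rewrite mulrDr; apply: idealMD.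
- by rewrite mulrA; apply: mem_idealM => //; apply: (ideal_mul iI).
Qed.

Lemma idealM_nzideal I J : is_nzideal F I -> is_nzideal F J -> is_nzideal F (idealM I J).
Proof.
move=> [iI [x Ix xN0]] [iJ [y Jy yN0]]; split; first exact: idealM_ideal.
by exists (x * y); [apply: mem_idealM | rewrite mulf_neq0].
Qed.

Lemma idealM_ringint I : is_ideal F I -> idealM I (ringint F) = I.
Proof.
move=> iI; apply/seteqP; split=> [|x Ix].
  by apply: (idealM_min_ideal iI) => x y Ix Oy; rewrite mulrC; apply: (ideal_mul iI).
by rewrite -[x]mulr1; apply: mem_idealM => //; in_ringint.
Qed.

Lemma scale_ideal I a : ringint F a -> is_ideal F I -> is_ideal F (scale a I).
Proof.
move=> Oa iI; split.
- by move=> _ [x /(ideal_ringint iI) Ox <-]; in_ringint.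
- by exists 0; [apply: (ideal0 iI) | rewrite mulr0].
- by move=> _ _ [x Ix <-] [y Iy <-]; rewrite -mulrDr; apply/mem_scale/(idealD iI).
- by move=> b _ Ob [x Ix <-]; rewrite mulrCA; apply/mem_scale/(ideal_mul iI).
Qed.

Lemma mem_scale_ringint a : scale a (ringint F) a.
Proof. by exists 1; rewrite ?mulr1 //; in_ringint. Qed.

Lemma scale_unit u : is_unit F u -> scale u (ringint F) = ringint F.
Proof.
move=> [Ou uN0 OuV]; apply/seteqP; split=> [_ [x Ox <-]|x Ox]; first by in_ringint.
by exists (u^-1 * x); [in_ringint | rewrite mulVKf].
Qed.

Lemma scale_ringint_eq a b : a != 0 -> b != 0 ->
  scale a (ringint F) = scale b (ringint F) -> is_unit F (a / b).
Proof.
move=> aN0 bN0 ab.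
have [x Ox xE] : scale a (ringint F) b by rewrite ab; apply: mem_scale_ringint.
have [y Oy yE] : scale b (ringint F) a by rewrite -ab; apply: mem_scale_ringint.
split; last by rewrite invf_div -xE mulrAC mulfV // mul1r.
  by rewrite -yE mulrAC mulfV // mul1r.
by rewrite mulf_neq0 ?invr_eq0.
Qed.

Definition ideal_equiv I J : Prop :=
  exists a b, [/\ ringint F a, ringint F b, a != 0, b != 0 & scale a I = scale b J].

Lemma ideal_equiv_refl I : ideal_equiv I I.
Proof. by exists 1, 1; split; rewrite ?oner_eq0 //; in_ringint. Qed.

Lemma ideal_equiv_sym I J : ideal_equiv I J -> ideal_equiv J I.
Proof. by move=> [a [b [? ? ? ? ?]]]; exists b, a; split. Qed.

Lemma ideal_equiv_trans I J L : ideal_equiv I J -> ideal_equiv J L -> ideal_equiv I L.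
Proof.
move=> [a [b [Oa Ob aN0 bN0 ab]]] [c [e [Oc Oe cN0 eN0 ce]]].
exists (c * a), (b * e); split; rewrite ?mulf_neq0 //; try by in_ringint.
by rewrite -scale_scale ab scale_scale -(scale_scale b e) -ce scale_scale mulrC.
Qed.

Lemma ideal_equivM I J I' J' :
  ideal_equiv I J -> ideal_equiv I' J' -> ideal_equiv (idealM I I') (idealM J J').
Proof.
move=> [a [b [Oa Ob aN0 bN0 ab]]] [c [e [Oc Oe cN0 eN0 ce]]].
exists (a * c), (b * e); split; rewrite ?mulf_neq0 //; try by in_ringint.
by rewrite -!idealM_scale ab ce.
Qed.

Lemma ideal_classP I J : is_nzideal F J ->
  (ideal_class F I = ideal_class F J) <-> ideal_equiv I J.
Proof.
move=> nJ; split=> [eqIJ|eqIJ].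
  have : ideal_class F J J by split=> //; apply: ideal_equiv_refl.
  by rewrite -eqIJ => -[].
apply/seteqP; split=> L [nL eqL]; split=> //.
  by apply: ideal_equiv_trans eqL => //; apply: ideal_equiv_sym.
exact: ideal_equiv_trans eqIJ eqL.
Qed.

Lemma ideal_class_idealMl I J L : is_nzideal F J -> is_nzideal F L ->
  ideal_class F I = ideal_class F J ->
  ideal_class F (idealM I L) = ideal_class F (idealM J L).
Proof.
move=> nJ nL /ideal_classP-/(_ nJ) IJ; apply/ideal_classP; first exact: idealM_nzideal.
by apply: ideal_equivM => //; apply: ideal_equiv_refl.
Qed.

Lemma classM_ideal_class I J : is_nzideal F I -> is_nzideal F J ->
  classM F (ideal_class F I) (ideal_class F J) = ideal_class F (idealM I J).
Proof.
move=> nI nJ; apply/seteqP; split=> [L [I' [J' [[nI' II'] [nJ' JJ'] [nL L']]]]|L LIJ].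
  by split=> //; apply: ideal_equiv_trans L' => //; apply: ideal_equivM.
by exists I, J; split=> //; split=> //; apply: ideal_equiv_refl.
Qed.

Lemma ideal_equiv_ringint I : is_nzideal F I ->
  ideal_equiv I (ringint F) <->
  exists a, [/\ F a, a != 0 & I = scale a (ringint F)].
Proof.
move=> [iI _]; split=> [[c [b [[Fc _] [Fb _] cN0 bN0 cb]]]|[a [Fa aN0 IE]]].
  exists (b / c); split; [by in_subfield | by rewrite mulf_neq0 ?invr_eq0 |].
  by apply: (scaleI cN0); rewrite cb scale_scale mulrC divfK.
exists 1, a; split; rewrite ?oner_eq0 ?scale1 //; first by in_ringint.
by apply: (ideal_ringint iI); rewrite IE; apply: mem_scale_ringint.
Qed.

End Ideals.

Section IdealExtension.

Variables F K : set algC.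
Hypotheses (sF : is_subfield F) (sK : is_subfield K) (FK : F `<=` K).

Lemma ideal_extM I J : ideal_ext K (idealM I J) = idealM (ideal_ext K I) (ideal_ext K J).
Proof. by rewrite /ideal_ext idealMACA (idealM_ringint sK (ringint_ideal sK)). Qed.

Lemma ideal_ext_scale a I : ideal_ext K (scale a I) = scale a (ideal_ext K I).
Proof. by rewrite /ideal_ext scale_idealM. Qed.

Lemma sub_ideal_ext I : I `<=` ideal_ext K I.
Proof. by move=> x Ix; rewrite -[x]mulr1; apply: mem_idealM => //; in_ringint. Qed.

Lemma ideal_ext_ringint : ideal_ext K (ringint F) = ringint K.
Proof.
apply/seteqP; split=> [|x Ox].
  by apply: (idealM_min_ideal (ringint_ideal sK)) => x y /(ringint_sub FK) ? ?; in_ringint.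
by rewrite -[x]mul1r; apply: mem_idealM => //; in_ringint.
Qed.

Lemma ideal_ext_ideal I : is_ideal F I -> is_ideal K (ideal_ext K I).
Proof.
move=> iI; split; [|exact: idealM0|by move=> y z; apply: idealMD|].
  apply: (idealM_min_ideal (ringint_ideal sK)) => x y /(ideal_ringint iI).
  by move=> /(ringint_sub FK) ? ?; in_ringint.
move=> a z Oa; move: z; apply: idealM_min => [|y z|y z Iy Oz].
- by rewrite mulr0; apply: idealM0.
- by rewrite mulrDr; apply: idealMD.
- by rewrite mulrCA; apply: mem_idealM => //; in_ringint.
Qed.

Lemma ideal_ext_nzideal I : is_nzideal F I -> is_nzideal K (ideal_ext K I).
Proof.
move=> [iI [x Ix xN0]]; split; first exact: ideal_ext_ideal.
by exists x => //; apply: sub_ideal_ext.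
Qed.

Lemma ideal_ext_equiv I J : ideal_equiv F I J ->
  ideal_equiv K (ideal_ext K I) (ideal_ext K J).
Proof.
move=> [a [b [/(ringint_sub FK) Oa /(ringint_sub FK) Ob aN0 bN0 ab]]].
by exists a, b; split; rewrite // -!ideal_ext_scale ab.
Qed.

Lemma capitulationP I : is_nzideal F I ->
  capitulation F K (ideal_class F I) <-> ideal_equiv K (ideal_ext K I) (ringint K).
Proof.
move=> nI; have nO := ringint_nzideal sK.
have extE : class_ext K (ideal_class F I) = ideal_class K (ideal_ext K I).
  apply/seteqP; split=> [L [J [nJ IJ] [nL JL]]|L LI].
    by split=> //; apply: ideal_equiv_trans JL => //; apply: ideal_ext_equiv.
  by exists I => //; split=> //; apply: ideal_equiv_refl.
rewrite /capitulation /= extE -ideal_classP //.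
by split=> [[]|] //; split=> //; exists I.
Qed.

Lemma capitulation_subgroup : is_Cl_subgroup F (capitulation F K).
Proof.
have nO := ringint_nzideal sF; have nO' := ringint_nzideal sK.
split.
- by move=> C [].
- by apply/capitulationP; rewrite // ideal_ext_ringint; apply: ideal_equiv_refl.
- move=> C D CC DD; case: (CC) (DD) => [[I nI CE] _] [[J nJ DE] _].
  move: CC DD; rewrite CE DE => /(capitulationP nI) CI /(capitulationP nJ) DJ.
  rewrite classM_ideal_class //; apply/capitulationP; first exact: idealM_nzideal.
  rewrite ideal_extM -[ringint K](idealM_ringint sK (ringint_ideal sK)).
  exact: ideal_equivM.
- move=> C D CC [J nJ ->]; case: (CC) => [[I nI CE] _].
  move: CC; rewrite CE => /(capitulationP nI) CI.
  rewrite classM_ideal_class // => /(ideal_classP sF _ nO)/ideal_ext_equiv.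
  rewrite ideal_extM ideal_ext_ringint => IJ; apply/capitulationP => //.
  rewrite -[ideal_ext K J](idealM_ringint sK (ideal_ext_ideal nJ.1)) idealMC.
  apply: ideal_equiv_trans IJ => //; apply: ideal_equivM => //.
    exact: ideal_equiv_sym.
  exact: ideal_equiv_refl.
Qed.

End IdealExtension.

Lemma Cl_subgroup F : is_subfield F -> is_Cl_subgroup F (Cl F).
Proof.
move=> sF; split=> // [|C D [I nI ->] [J nJ ->]].
  by exists (ringint F) => //; apply: ringint_nzideal.
by exists (idealM I J); [apply: idealM_nzideal | apply: classM_ideal_class].
Qed.

Lemma Cl_gen_min F S G : is_Cl_subgroup F G -> S `<=` G -> Cl_gen F S `<=` G.
Proof. by move=> sG SG C; apply; split. Qed.

Lemma sub_Cl_gen F S : S `<=` Cl_gen F S.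
Proof. by move=> C SC G [_]; apply. Qed.

Lemma Cl_gen_subgroup F S : is_subfield F -> S `<=` Cl F -> is_Cl_subgroup F (Cl_gen F S).
Proof.
move=> sF SC; have sC := Cl_subgroup sF; split.
- by move=> C; apply; split.
- by move=> G [[]].
- move=> C D CS DS G SG; have [[_ _ GM _] _] := SG.
  by apply: GM; [apply: CS | apply: DS].
- move=> C D CS CD CD1 G SG; have [[_ _ _ GV] _] := SG.
  by apply: GV CD1 => //; apply: CS.
Qed.

(** * Squares modulo a group of units *)

Definition mul_subgroup (U : set algC) : Prop :=
  [/\ U 1, forall u, U u -> u != 0 & forall u v, U u -> U v -> U (u / v)].

Section MulSubgroup.

Variable U : set algC.
Hypothesis sU : mul_subgroup U.

Lemma mul_subgroup1 : U 1. Proof. by case: sU. Qed.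

Lemma mul_subgroup_neq0 u : U u -> u != 0. Proof. by case: sU => _ UN0 _ /UN0. Qed.

Lemma mul_subgroup_div u v : U u -> U v -> U (u / v).
Proof. by case: sU => _ _ UV; apply: UV. Qed.

Lemma mul_subgroupV u : U u -> U u^-1.
Proof.
by move=> Uu; rewrite -div1r; apply: mul_subgroup_div => //; apply: mul_subgroup1.
Qed.

Lemma mul_subgroupM u v : U u -> U v -> U (u * v).
Proof.
by move=> Uu Uv; rewrite -[v]invrK; apply: mul_subgroup_div => //; apply: mul_subgroupV.
Qed.

Lemma mul_subgroupX n u : U u -> U (u ^+ n).
Proof.
move=> Uu; elim: n => [|n IHn]; first exact: mul_subgroup1.
by rewrite exprS; apply: mul_subgroupM.
Qed.

Lemma mul_subgroup_cancel u v : U (u * v) -> U u -> U v.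
Proof.
move=> Uuv Uu; rewrite -[v](mulKf (mul_subgroup_neq0 Uu)) mulrC.
exact: mul_subgroup_div.
Qed.

End MulSubgroup.

Definition powers (z : algC) : set algC := [set z ^ n | n in [set: int]].

Lemma powers_subgroup z : z != 0 -> mul_subgroup (powers z).
Proof.
move=> zN0; split=> [|_ [n _ <-]|_ _ [m _ <-] [n _ <-]].
- by exists 0.
- exact: expfz_neq0.
- by exists (m - n); rewrite // expfzDr // -invr_expz.
Qed.

Lemma powersN1_subgroup : mul_subgroup (powers (-1)).
Proof. by apply: powers_subgroup; rewrite oppr_eq0 oner_eq0. Qed.

Lemma powers_i_subgroup : mul_subgroup (powers 'i).
Proof. exact/powers_subgroup/neq0Ci. Qed.

Lemma powers_sub U z : mul_subgroup U -> U z -> powers z `<=` U.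
Proof.
move=> sU Uz _ [n _ <-]; case: n => n; first exact: (mul_subgroupX sU).
by rewrite NegzE -exprnN; apply: (mul_subgroupV sU); apply: (mul_subgroupX sU).
Qed.

Lemma powersX z n : powers z (z ^+ n).
Proof. by exists n%:Z. Qed.

Lemma powersN1P u : powers (-1) u <-> u = 1 \/ u = -1.
Proof.
split=> [[n _ <-]|[]->]; [|exact: (@powersX _ 0)|exact: (@powersX _ 1)].
have : ((-1) ^ n) ^+ 2 = 1 :> algC.
  by rewrite exprnP exprz_exp mulrC -exprz_exp -[_ ^ 2]exprnP sqrrN expr1n exp1rz.
by move/eqP; rewrite sqrf_eq1 => /orP[]/eqP; [left | right].
Qed.

Lemma powersN1_i : powers (-1) `<=` powers 'i.
Proof.
by move=> _ [n _ <-]; exists (2 * n); rewrite // -exprz_exp -[_ ^ 2]exprnP sqrCi.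
Qed.

Lemma is_unit_subgroup F : is_subfield F -> mul_subgroup (is_unit F).
Proof.
move=> sF; split=> [|u []|u v [Ou uN0 OuV] [Ov vN0 OvV]] //.
  by split; rewrite ?invr1 ?oner_eq0 //; in_ringint.
by split; rewrite ?invf_div ?mulf_neq0 ?invr_eq0 //; in_ringint.
Qed.

Lemma is_unit_sub (F K : set algC) : F `<=` K -> is_unit F `<=` is_unit K.
Proof. by move=> FK u [Ou uN0 OuV]; split=> //; apply: (ringint_sub FK). Qed.

Lemma is_unit_sqr F u : is_subfield F -> F u -> is_unit F (u ^+ 2) -> is_unit F u.
Proof.
move=> sF Fu [[_ Au2] u2N0 [_ Au2V]]; split; [exact: ringint_sqr|by rewrite -sqrf_eq0|].
by apply: ringint_sqr; [in_subfield | rewrite exprVn].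
Qed.

Lemma is_unit_i F : is_subfield F -> F 'i -> is_unit F 'i.
Proof.
move=> sF Fi; split; [by split; last exact: Aint_i | exact: neq0Ci |].
by rewrite invCi; split; [in_subfield | rewrite rpredN Aint_i].
Qed.

Definition square_mod (U F : set algC) : set algC :=
  [set z | exists u c, [/\ U u, F c, c != 0 & z = u * c ^+ 2]].

Lemma square_mod_sub (U V F K : set algC) :
  U `<=` V -> F `<=` K -> square_mod U F `<=` square_mod V K.
Proof.
move=> UV FK z [u [c [Uu Fc cN0 zE]]].
by exists u, c; split=> //; [apply: UV | apply: FK].
Qed.

Section SquareMod.

Variables U F : set algC.
Hypotheses (sU : mul_subgroup U) (sF : is_subfield F).

Lemma square_mod_subgroup : mul_subgroup (square_mod U F).
Proof.
split=> [|_ [u [c [/(mul_subgroup_neq0 sU) uN0 _ cN0 ->]]]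
        |_ _ [u [c [Uu Fc cN0 ->]]] [v [e [Uv Fe eN0 ->]]]].
- exists 1, 1; rewrite oner_eq0 expr1n mulr1.
  by split=> //; [apply: mul_subgroup1 | in_subfield].
- by rewrite mulf_neq0 ?expf_neq0.
- exists (u / v), (c / e); split; [exact: mul_subgroup_div|by in_subfield| |].
    by rewrite mulf_neq0 ?invr_eq0.
  by field; rewrite eN0 (mul_subgroup_neq0 sU Uv).
Qed.

Lemma square_mod_unit u : U u -> square_mod U F u.
Proof.
by move=> Uu; exists u, 1; rewrite oner_eq0 expr1n mulr1; split=> //; in_subfield.
Qed.

Lemma square_mod_sqr c : F c -> c != 0 -> square_mod U F (c ^+ 2).
Proof. by move=> Fc cN0; exists 1, c; rewrite mul1r; split=> //; apply: mul_subgroup1. Qed.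

Lemma square_mod_trans a b c : F b -> b != 0 ->
  square_mod U F (a * b) -> square_mod U F (b * c) -> square_mod U F (a * c).
Proof.
move=> Fb bN0 ab bc; have sT := square_mod_subgroup.
apply: (mul_subgroup_cancel sT) (square_mod_sqr Fb bN0).
have -> : b ^+ 2 * (a * c) = a * b * (b * c) by ring.
exact: mul_subgroupM.
Qed.

Lemma square_mod_exp_absz z (n : int) : F z -> z != 0 ->
  square_mod U F (z ^ n * z ^+ `|n|).
Proof.
move=> Fz zN0; case: n => n.
  by rewrite -exprnP -expr2; apply: square_mod_sqr; rewrite ?expf_neq0 //; in_subfield.
rewrite NegzE abszN absz_nat -exprnN mulVf ?expf_neq0 //.
exact: mul_subgroup1 square_mod_subgroup.
Qed.

Lemma sqr_norm_add (w w' n : algC) :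
  w * w' = n ^+ 2 -> w * (w + w' + 2 * n) = (w + n) ^+ 2.
Proof. by rewrite mulrDr mulrDr => ->; ring. Qed.

Lemma square_mod_norm (w w' n : algC) : F w -> F n -> w != 0 -> w + w' + 2 * n != 0 ->
  w * w' = n ^+ 2 -> square_mod U F (w * (w + w' + 2 * n)).
Proof.
move=> Fw Fn wN0 trN0 ww'; rewrite (sqr_norm_add ww').
apply: square_mod_sqr; first by in_subfield.
by rewrite -sqrf_eq0 -(sqr_norm_add ww') mulf_neq0.
Qed.

End SquareMod.

Lemma two_eq_i3_sqr : 2 = 'i ^+ 3 * (1 + 'i) ^+ 2 :> algC.
Proof.
have i2 := sqrCi algC.
transitivity ('i * ('i ^+ 2 * (1 + 2 * 'i + 'i ^+ 2)) : algC); last by ring.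
rewrite i2; transitivity (- 2 * 'i ^+ 2 : algC); last by ring.
by rewrite i2; ring.
Qed.

Lemma square_mod_2 U F : is_subfield F -> F 'i -> U ('i ^+ 3) -> square_mod U F 2.
Proof.
move=> sF Fi Ui; exists ('i ^+ 3), (1 + 'i); split=> //.
- by in_subfield.
- apply: contraTneq isT => i1; have := two_eq_i3_sqr.
  by rewrite i1 expr0n mulr0 => /eqP; rewrite pnatr_eq0.
- exact: two_eq_i3_sqr.
Qed.

(** * Ideals with principal square *)

Definition ideal_sqrt (F : set algC) (a : algC) (I : set algC) : Prop :=
  [/\ is_ideal F I, ringint F a, a != 0 & idealM I I = scale a (ringint F)].

Section IdealSqrt.

Variable F : set algC.
Hypothesis sF : is_subfield F.

(* For z in the right-hand side and w in I, (z w / a)^2 is integral, hence so is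
   z w / a; thus z I <= I^2, and multiplying by I gives z a in a I. *)
Lemma ideal_sqrtE a I : ideal_sqrt F a I ->
  I = [set z | ringint F z /\ scale a (ringint F) (z ^+ 2)].
Proof.
move=> [iI [Fa _] aN0 I2]; apply/seteqP; split=> [z Iz|z [Oz [b Ob bE]]].
  by split; [apply: (ideal_ringint iI) | rewrite -I2 expr2; apply: mem_idealM].
have zI w : I w -> scale a (ringint F) (z * w).
  move=> Iw; have Ow := ideal_ringint iI Iw.
  have [c Oc cE] : scale a (ringint F) (w ^+ 2).
    by rewrite -I2 expr2; apply: mem_idealM.
  exists (z * w / a); last by rewrite mulrC divfK.
  apply: ringint_sqr; first by case: Oz Ow => ? _ [? _]; in_subfield.
  have -> : (z * w / a) ^+ 2 = b * c by rewrite expr_div_n exprMn -bE -cE; field.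
  by case: (ringintM sF Ob Oc).
have [z' Iz' zE] : scale a I (z * a).
  suff: idealM I I `<=` [set t | scale a I (z * t)].
    by apply; rewrite I2; apply: mem_scale_ringint.
  apply: idealM_min => /=.
  - by rewrite mulr0; exists 0; rewrite ?mulr0 //; apply: (ideal0 iI).
  - move=> x y [x' Ix' xE] [y' Iy' yE]; exists (x' + y'); first exact: (idealD iI).
    by rewrite !mulrDr xE yE.
  - move=> x y /zI[t Ot tE] Iy; exists (t * y); first exact: (ideal_mul iI).
    by rewrite !mulrA tE.
by suff -> : z = z' by []; apply: (mulfI aN0); rewrite zE mulrC.
Qed.

Lemma ideal_sqrt_inj a I J : ideal_sqrt F a I -> ideal_sqrt F a J -> I = J.
Proof. by move=> /ideal_sqrtE-> /ideal_sqrtE->. Qed.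

Lemma ideal_sqrt_nzideal a I : ideal_sqrt F a I -> is_nzideal F I.
Proof.
move=> aI; have [iI Oa aN0 _] := aI; split=> //; exists a => //.
by rewrite (ideal_sqrtE aI); split=> //; rewrite expr2; apply: mem_scale.
Qed.

Lemma ideal_sqrt_scale a t I : ringint F t -> t != 0 -> ideal_sqrt F a I ->
  ideal_sqrt F (t ^+ 2 * a) (scale t I).
Proof.
move=> Ot tN0 [iI Oa aN0 I2]; split.
- exact: scale_ideal.
- by rewrite expr2; in_ringint.
- by rewrite mulf_neq0 ?expf_neq0.
- by rewrite idealM_scale I2 scale_scale expr2.
Qed.

Lemma ideal_sqrt_unit a u I : is_unit F u -> ideal_sqrt F a I -> ideal_sqrt F (a * u) I.
Proof.
move=> uU; have [Ou uN0 _] := uU; move=> [iI Oa aN0 I2]; split=> //; first by in_ringint.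
  by rewrite mulf_neq0.
by rewrite I2 -scale_scale (scale_unit sF uU).
Qed.

Lemma ideal_sqrtM a b I J : ideal_sqrt F a I -> ideal_sqrt F b J ->
  ideal_sqrt F (a * b) (idealM I J).
Proof.
move=> [iI Oa aN0 I2] [iJ Ob bN0 J2]; split.
- exact: idealM_ideal.
- by in_ringint.
- by rewrite mulf_neq0.
- by rewrite idealMACA I2 J2 idealM_scale (idealM_ringint sF (ringint_ideal sF)).
Qed.

Lemma ideal_sqrt1 : ideal_sqrt F 1 (ringint F).
Proof.
split; [exact: ringint_ideal|by in_ringint|exact: oner_neq0|].
by rewrite scale1 (idealM_ringint sF (ringint_ideal sF)).
Qed.

Lemma ideal_sqrt_class a b I J : ideal_sqrt F a I -> ideal_sqrt F b J ->
  square_mod (is_unit F) F (a * b) -> ideal_class F I = ideal_class F J.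
Proof.
move=> aI bJ [u [c [uU Fc cN0 abE]]]; apply/ideal_classP => //.
  exact: ideal_sqrt_nzideal bJ.
have [[_ Oa aN0 _] [_ Ob bN0 _]] := (aI, bJ); have [_ uN0 OuV] := uU.
have c2E : c ^+ 2 = a * b * u^-1 by rewrite abE mulrAC mulfV // mul1r.
have Oc : ringint F c.
  apply: ringint_sqr => //; have : ringint F (c ^+ 2) by rewrite c2E; in_ringint.
  by case.
exists b, c; split=> //; apply: ideal_sqrt_inj (ideal_sqrt_scale Ob bN0 aI) _.
have -> : b ^+ 2 * a = c ^+ 2 * b * u by rewrite c2E; field.
by apply: ideal_sqrt_unit => //; apply: ideal_sqrt_scale.
Qed.

Lemma ideal_sqrt_class_idealMl a b I J : ideal_sqrt F a I -> ideal_sqrt F b J ->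
    square_mod (is_unit F) F (a * b) ->
  forall c L, ideal_sqrt F c L -> ideal_class F (idealM I L) = ideal_class F (idealM J L).
Proof.
move=> aI bJ ab c L cL; apply: ideal_class_idealMl => //.
- exact: ideal_sqrt_nzideal bJ.
- exact: ideal_sqrt_nzideal cL.
- exact: ideal_sqrt_class aI bJ ab.
Qed.

End IdealSqrt.

Lemma ideal_sqrt_ext F K a I : is_subfield F -> is_subfield K -> F `<=` K ->
  ideal_sqrt F a I -> ideal_sqrt K a (ideal_ext K I).
Proof.
move=> sF sK FK [iI Oa aN0 I2]; split=> //; first exact: (ideal_ext_ideal sK FK).
  exact: (ringint_sub FK).
by rewrite -ideal_extM // I2 ideal_ext_scale (ideal_ext_ringint sF).
Qed.

Lemma capitulation_sqrt F K a I : is_subfield F -> is_subfield K -> F `<=` K ->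
    ideal_sqrt F a I -> square_mod (is_unit K) K a ->
  capitulation F K (ideal_class F I).
Proof.
move=> sF sK FK aI Ka; apply/capitulationP => //; first exact: ideal_sqrt_nzideal aI.
apply/ideal_classP => //; first exact: ringint_nzideal.
by apply: (ideal_sqrt_class sK (ideal_sqrt_ext sF sK FK aI) (ideal_sqrt1 sK));
  rewrite mulr1.
Qed.

(** * Ideals in quadratic extensions *)

Section QuadraticExtension.

Variables (F K : set algC) (sg : {rmorphism algC -> algC}).
Hypotheses (sF : is_subfield F) (sK : is_subfield K) (FK : F `<=` K).
Hypothesis sg_conj : is_quad_conj F K sg.

Let fixF z : F z -> sg z = z. Proof. by case: sg_conj => fix_F _ _ _ /fix_F. Qed.
Let sgK z : K z -> sg (sg z) = z. Proof. by case: sg_conj => _ _ sg_inv _ /sg_inv. Qed.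

Lemma ringint_conj z : ringint K z -> ringint K (sg z).
Proof. by case: sg_conj => _ KK _ _ [/KK Ksz Az]; split; rewrite ?Aint_aut. Qed.

Lemma ringint_fixed z : ringint K z -> sg z = z -> ringint F z.
Proof. by case: sg_conj => _ _ _ fixK [/fixK Fz Az] /Fz. Qed.

Lemma ringint_trace z : ringint K z -> ringint F (z + sg z).
Proof.
move=> Oz; have Osz := ringint_conj Oz; apply: ringint_fixed; first by in_ringint.
by rewrite rmorphD sgK 1?addrC //; case: Oz.
Qed.

Lemma ringint_norm z : ringint K z -> ringint F (z * sg z).
Proof.
move=> Oz; have Osz := ringint_conj Oz; apply: ringint_fixed; first by in_ringint.
by rewrite rmorphM sgK 1?mulrC //; case: Oz.
Qed.

Lemma ideal_ext_conj I z : is_ideal F I -> ideal_ext K I z -> ideal_ext K I (sg z).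
Proof.
move=> iI; move: z; apply: idealM_min => [|x y|x y Ix Oy].
- by rewrite rmorph0; apply: idealM0.
- by rewrite rmorphD; apply: idealMD.
- rewrite rmorphM fixF; last by case: (ideal_ringint iI Ix).
  by apply: mem_idealM => //; apply: ringint_conj.
Qed.

Lemma ideal_ext_trace I z : is_ideal F I -> ideal_ext K I z -> I (z + sg z).
Proof.
move=> iI; move: z; apply: idealM_min => [|x y Ix Iy|x y Ix Oy].
- by rewrite rmorph0 addr0; apply: (ideal0 iI).
- by rewrite rmorphD addrACA; apply: (idealD iI).
- have [Fx _] := ideal_ringint iI Ix.
  rewrite rmorphM (fixF Fx) -mulrDr mulrC.
  by apply: (ideal_mul iI) => //; apply: ringint_trace.
Qed.

(* The cross terms of the norm of a sum are traces from I^2 O_K. *)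
Lemma ideal_ext_norm I z : is_ideal F I -> ideal_ext K I z -> idealM I I (z * sg z).
Proof.
move=> iI Iz; have iI2 := idealM_ideal sF iI iI.
suff: ideal_ext K I `<=` [set s | ideal_ext K I s /\ idealM I I (s * sg s)].
  by move=> /(_ z Iz)[].
apply: idealM_min => [|x y [Ix Nx] [Iy Ny]|x y Ix Oy] /=.
- by rewrite mul0r; split; apply: idealM0.
- split; first exact: idealMD.
  have -> : (x + y) * sg (x + y) = x * sg x + y * sg y + (x * sg y + sg (x * sg y)).
    have Ky : K y by case: (ideal_ringint (ideal_ext_ideal sK FK iI) Iy).
    by rewrite rmorphD rmorphM (sgK Ky); ring.
  apply: idealMD; first exact: idealMD.
  apply: ideal_ext_trace => //; rewrite ideal_extM //.
  by apply: mem_idealM => //; apply: ideal_ext_conj.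
- split; first exact: mem_idealM.
  have [Fx _] := ideal_ringint iI Ix.
  have -> : x * y * sg (x * y) = x * (y * sg y * x) by rewrite rmorphM (fixF Fx); ring.
  by apply: mem_idealM => //; apply: (ideal_mul iI) => //; apply: ringint_norm.
Qed.

Lemma capitulation_norm I : is_nzideal F I -> capitulation F K (ideal_class F I) ->
  exists al, [/\ K al, al != 0, is_unit K (al / sg al) & ideal_sqrt F (al * sg al) I].
Proof.
move=> nI /(capitulationP sF sK FK nI).
move=> /(ideal_equiv_ringint sK (ideal_ext_nzideal sK FK nI))[al [Kal alN0 extE]].
have iI := nI.1; exists al.
have sgalN0 : sg al != 0 by rewrite fmorph_eq0.
have Oal : ringint K al.
  apply: (ideal_ringint (ideal_ext_ideal sK FK iI)).
  by rewrite extE; apply: mem_scale_ringint.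
have ext_al : ideal_ext K I al by rewrite extE; apply: mem_scale_ringint.
have eq_sg : scale al (ringint K) = scale (sg al) (ringint K).
  have [u Ou uE] : scale al (ringint K) (sg al) by rewrite -extE; apply: ideal_ext_conj.
  have alE : al = sg al * sg u by rewrite -rmorphM uE sgK.
  apply/seteqP; split=> _ [x Ox <-].
    have Osu := ringint_conj Ou.
    by exists (sg u * x); [in_ringint | rewrite mulrA -alE].
  by exists (u * x); [in_ringint | rewrite mulrA uE].
split=> //; first exact: scale_ringint_eq.
split=> //; [exact: ringint_norm | by rewrite mulf_neq0 |].
apply/seteqP; split=> [|_ [x Ox <-]]; last first.
  by rewrite mulrC; apply: (ideal_mul (idealM_ideal sF iI iI)) => //; apply: ideal_ext_norm.
have i_alO := scale_ideal sF (ringint_norm Oal) (ringint_ideal sF).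
apply: (idealM_min_ideal i_alO) => x y Ix Iy.
exists (x * y / (al * sg al)); last by rewrite mulrC divfK // mulf_neq0.
have [x' [_ Ax'] xE] : scale al (ringint K) x by rewrite -extE; apply: sub_ideal_ext.
have [y' [_ Ay'] yE] : scale (sg al) (ringint K) y.
  by rewrite -eq_sg -extE; apply: sub_ideal_ext.
have [[Fx _] [Fy _]] := (ideal_ringint iI Ix, ideal_ringint iI Iy).
have [FN _] := ringint_norm Oal; split; first by in_subfield.
have -> : x * y / (al * sg al) = x' * y' by rewrite -xE -yE; field; apply/andP.
by rewrite rpredM.
Qed.

End QuadraticExtension.

(* If alpha generates I O_K, then alpha^2 is the product of c = N(alpha), which generates
   I^2, and of the unit alpha / sg(alpha) of relative norm 1. *)
Lemma capitulation_sqrt_class (F : set algC) (s A : algC) (sg : {rmorphism algC -> algC})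
    (K := adjoin F [set s]) (I : set algC) :
    is_subfield F -> F (s ^+ 2) -> s != 0 -> (forall z, F z -> sg z = z) -> sg s = - s ->
    F A -> A != 0 ->
    (forall eta, is_unit K eta -> eta * sg eta = 1 ->
      exists n, square_mod (is_unit F) K (eta * A ^+ n)) ->
    is_nzideal F I -> capitulation F K (ideal_class F I) ->
  exists c n (b : bool), ideal_sqrt F c I /\
    square_mod (is_unit F) F (c * A ^+ n * (s ^+ 2) ^+ b).
Proof.
move=> sF Fs2 sN0 fixF sgs FA AN0 unitK nI; have sU := is_unit_subgroup sF.
have sK : is_subfield K by apply: adjoin_subfield.
have FK : F `<=` K by apply: sub_adjoin.
have sg_conj := adjoin_sqrt_quad_conj sF Fs2 fixF sgs; have [_ KK sgK _] := sg_conj.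
move=> /(capitulation_norm sF sK FK sg_conj nI)[al [Kal alN0 etaU alI]].
have sgalN0 : sg al != 0 by rewrite fmorph_eq0.
have [|n [u [t [uU Kt tN0 etaE]]]] := unitK _ etaU.
  by rewrite fmorph_div sgK //; field; apply/andP.
have uN0 := mul_subgroup_neq0 sU uU.
pose c := al * sg al; pose W := al * A ^+ n / t.
have W2 : W ^+ 2 = u * (c * A ^+ n).
  transitivity (c * A ^+ n * (al / sg al * A ^+ n) / t ^+ 2); last by rewrite etaE; field.
  by rewrite /W /c; field; apply/andP.
have WN0 : W != 0 by rewrite mulf_neq0 ?invr_eq0 // mulf_neq0 ?expf_neq0.
have KA := FK _ FA; have KW : K W by rewrite /W; in_subfield.
have FW2 : F (W ^+ 2).
  by rewrite W2; have [_ [? _] _ _] := alI; have [[? _] _ _] := uU; in_subfield.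
exists c, n; have [FW|FWs] := adjoin_sqr_cases sF Fs2 KW FW2.
  exists false; split=> //; exists u^-1, W; split=> //; first exact: mul_subgroupV.
  by rewrite W2 mulr1 mulKf.
exists true; split=> //; exists u^-1, (W * s); split=> //; first exact: mul_subgroupV.
  by rewrite mulf_neq0.
by rewrite [(W * s) ^+ 2]exprMn W2 expr1 -(mulrA u) mulKf.
Qed.

Definition coprime_in (F : set algC) (a b : algC) : Prop :=
  exists x y, [/\ ringint F x, ringint F y & x * a + y * b = 1].

Lemma coprime_inMr F a b c : is_subfield F -> ringint F a -> ringint F b ->
  coprime_in F a b -> coprime_in F a c -> coprime_in F a (b * c).
Proof.
move=> sF Oa Ob [x [y [Ox Oy xyE]]] [z [t [Oz Ot ztE]]].
exists (x + y * b * z), (y * t); split; try by in_ringint.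
have -> : (x + y * b * z) * a + y * t * (b * c) = x * a + y * b * (z * a + t * c) by ring.
by rewrite ztE mulr1.
Qed.

Lemma coprime_in_nat F m n : is_subfield F -> coprime m n -> coprime_in F m%:R n%:R.
Proof.
move=> sF; rewrite -[coprime m n]/(coprimez m%:Z n%:Z) => /coprimezP[[x y] /= xyE].
exists x%:~R, y%:~R; split; try by in_ringint.
by rewrite -[m%:R]/(m%:~R) -[n%:R]/(n%:~R) -!intrM -intrD xyE.
Qed.

Section RamifiedPrime.

Variables (F : set algC) (s pi rho : algC) (sg : {rmorphism algC -> algC}) (H : set algC).
Let K := adjoin F [set s].
Hypotheses (sF : is_subfield F) (fixF : forall z, F z -> sg z = z) (sgs : sg s = - s).
Hypotheses (Opi : ringint F pi) (Orho : ringint F rho) (piN0 : pi != 0).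
Hypotheses (co_pi_rho : coprime_in F pi rho) (s2E : s ^+ 2 = pi * rho).
Hypothesis Habove : prime_above F K pi H.

Let sK : is_subfield K. Proof. exact: adjoin_subfield. Qed.
Let FK : F `<=` K. Proof. exact: sub_adjoin. Qed.
Let OFK : ringint F `<=` ringint K. Proof. exact: ringint_sub. Qed.
Let iH : is_ideal K H. Proof. by case: Habove => -[]. Qed.
Let sg_conj : is_quad_conj F K sg.
Proof. by apply: adjoin_sqrt_quad_conj; rewrite // s2E; case: (ringintM sF Opi Orho). Qed.

Let H_ringint z : H z -> ringint F z -> scale pi (ringint F) z.
Proof. by case: Habove => _ <-. Qed.

Let H_radical z : ringint K z -> H (z ^+ 2) -> H z.
Proof. by case: Habove => -[_ _ Hprime] _ Oz; rewrite expr2 => /Hprime-/(_ Oz Oz)[]. Qed.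

Let Os : ringint K s.
Proof.
apply: ringint_sqr; first exact: adjoin_gen.
by rewrite s2E; case: (ringintM sF Opi Orho).
Qed.

Lemma ramified_prime_pi : H pi.
Proof.
have : scale pi (ringint F) pi by apply: mem_scale_ringint.
by case: Habove => _ <- [].
Qed.

Lemma ramified_prime_sqrt : H s.
Proof.
apply: H_radical; first exact: Os.
rewrite s2E mulrC; apply: (ideal_mul iH); first exact: OFK.
exact: ramified_prime_pi.
Qed.

(* w s is then pi c with c integral in F, so rho w^2 = pi c^2 and pi divides w^2. *)
Lemma ramified_prime_antifixed w : ringint K w -> sg w = - w -> H w.
Proof.
move=> Ow sgw; have [x [y [Ox Oy xyE]]] := co_pi_rho.
have Ows : ringint F (w * s).
  apply: (ringint_fixed sg_conj); first by in_ringint; exact: Os.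
  by rewrite rmorphM sgw sgs mulrNN.
have [c Oc cE] : scale pi (ringint F) (w * s).
  by apply: H_ringint => //; apply: (ideal_mul iH) => //; apply: ramified_prime_sqrt.
have rho_w2 : rho * w ^+ 2 = pi * c ^+ 2.
  apply: (mulfI piN0); transitivity ((w * s) ^+ 2); last by rewrite -cE; ring.
  by rewrite exprMn s2E; ring.
apply: H_radical => //.
have -> : w ^+ 2 = (x * w ^+ 2 + y * c ^+ 2) * pi.
  transitivity (x * pi * w ^+ 2 + y * (rho * w ^+ 2)); last by rewrite rho_w2; ring.
  by rewrite mulrA -mulrDl xyE mul1r.
apply: (ideal_mul iH); last exact: ramified_prime_pi.
by rewrite !expr2; have := OFK Ox; have := OFK Oy; have := OFK Oc => ? ? ?; in_ringint.
Qed.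

(* z^2 = z (z + sg z) - z sg(z), where z + sg z = 2 z - (z - sg z). *)
Lemma ramified_prime_sqr z : H z -> scale pi (ringint K) (z ^+ 2).
Proof.
move=> Hz; have Oz := ideal_ringint iH Hz; have Osz := ringint_conj sg_conj Oz.
have [t Ot tE] : scale pi (ringint F) (z + sg z).
  apply: H_ringint; last exact: (ringint_trace sK sg_conj).
  have -> : z + sg z = 2 * z + (-1)%:~R * (z - sg z) by rewrite mulrN1z; ring.
  apply: (idealD iH); apply: (ideal_mul iH) => //; try by in_ringint.
  apply: ramified_prime_antifixed; first by in_ringint.
  by have [_ _ sgK _] := sg_conj; rewrite rmorphB sgK ?opprB //; case: Oz.
have [n On nE] : scale pi (ringint F) (z * sg z).
  apply: H_ringint; last exact: (ringint_norm sK sg_conj).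
  by rewrite mulrC; apply: (ideal_mul iH).
exists (z * t - n); first by have := OFK Ot; have := OFK On => ? ?; in_ringint.
by rewrite mulrBr nE mulrCA tE; ring.
Qed.

Lemma ramified_prime_ideal_sqrt : ideal_sqrt K pi H.
Proof.
have iH2 := idealM_ideal sK iH iH; split=> //; first exact: OFK.
apply/seteqP; split=> [|_ [b Ob <-]].
  apply: (idealM_min_ideal (scale_ideal sK (OFK Opi) (ringint_ideal sK))) => x y Hx Hy.
  exists (x * y / pi); last by rewrite mulrC divfK.
  have [a Oa aE] := ramified_prime_sqr Hx; have [b Ob bE] := ramified_prime_sqr Hy.
  have [[Kx _] [Ky _]] := (ideal_ringint iH Hx, ideal_ringint iH Hy).
  have [Kpi _] := OFK Opi; apply: ringint_sqr; first by in_subfield.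
  have -> : (x * y / pi) ^+ 2 = a * b by rewrite expr_div_n exprMn -aE -bE; field.
  by case: (ringintM sK Oa Ob).
have [x [y [Ox Oy xyE]]] := co_pi_rho.
rewrite mulrC; apply: (ideal_mul iH2) => //.
have -> : pi = x * (pi * pi) + y * (s * s).
  rewrite -[s * s]expr2 s2E; transitivity ((x * pi + y * rho) * pi); last by ring.
  by rewrite xyE mul1r.
apply: (idealD iH2); apply: (ideal_mul iH2); try exact: OFK; apply: mem_idealM;
  by [exact: ramified_prime_pi | exact: ramified_prime_sqrt].
Qed.

End RamifiedPrime.

(** * Squarefree integers *)

Lemma coprime_mul_sqr (a b c : nat) :
  coprime a b -> (a * b = c ^ 2)%N -> exists s, a = (s ^ 2)%N.
Proof.
move=> co_ab abE; exists (gcdn a c).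
apply/eqP; rewrite eqn_dvd; apply/andP; split.
  have -> : (gcdn a c ^ 2 = gcdn (a * gcdn a c) (c * gcdn a c))%N.
    by rewrite -muln_gcdl.
  rewrite dvdn_gcd dvdn_mulr //=.
  have -> : (c * gcdn a c = gcdn (c * a) (c * c))%N by rewrite -muln_gcdr.
  by rewrite dvdn_gcd dvdn_mull // mulnn -abE dvdn_mulr.
have co_gb : coprime (gcdn a c ^ 2) b.
  by rewrite coprimeXl // (coprime_dvdl (dvdn_gcdl a c)).
by rewrite -(Gauss_dvdl _ co_gb) abE dvdn_exp2r // dvdn_gcdr.
Qed.

Lemma mul_eq_sqr_gcd (m n b : int) : m * n = b ^+ 2 -> m != 0 ->
  exists (G : nat) (s : int) (e : bool),
    [/\ m = (-1) ^+ e * (G%:Z * s ^+ 2), (G%:Z %| m)%Z, (G%:Z %| n)%Z & (G%:Z %| b)%Z].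
Proof.
move=> mnE mN0; pose M := `|m|%N; pose N := `|n|%N; pose B := `|b|%N.
have MNE : (M * N = B ^ 2)%N by rewrite /M /N /B -abszM mnE abszX.
have M_gt0 : (0 < M)%N by rewrite absz_gt0.
pose G := gcdn M N.
have G_gt0 : (0 < G)%N by rewrite gcdn_gt0 M_gt0.
have [M' ME] : exists M', M = (M' * G)%N by apply/dvdnP; apply: dvdn_gcdl.
have [N' NE] : exists N', N = (N' * G)%N by apply/dvdnP; apply: dvdn_gcdr.
have co : coprime M' N'.
  by rewrite /coprime -(eqn_pmul2r G_gt0) mul1n muln_gcdl -ME -NE.
have GB : (G %| B)%N.
  by rewrite -(@dvdn_pexp2r _ _ 2) // -MNE ME NE; apply/dvdnP; exists (M' * N')%N; ring.
have [B' BE] : exists B', B = (B' * G)%N by apply/dvdnP.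
have [|s sE] := @coprime_mul_sqr M' N' B' co.
  apply/eqP; rewrite -(@eqn_pmul2r (G ^ 2)) ?expn_gt0 ?G_gt0 //; apply/eqP.
  by rewrite -expnMn -BE -MNE ME NE; ring.
exists G, s%:Z, (m < 0); split; rewrite ?dvdzE ?dvdn_gcdl ?dvdn_gcdr //.
rewrite {1}(intEsign m); congr (_ * _); rewrite -/M ME sE mulnC PoszM.
by rewrite -rmorphXn.
Qed.

Lemma dvdn_mul_prime_split (G m p : nat) : prime p -> (G %| m * p)%N ->
  exists (b : bool) (G' : nat), (G' %| m)%N /\ G = (G' * p ^ b)%N.
Proof.
move=> pp Gmp; have [pG|pG] := boolP (p %| G)%N.
  exists true, (G %/ p)%N; rewrite expn1 divnK //; split=> //.
  by rewrite -(@dvdn_pmul2r p) ?prime_gt0 // divnK.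
exists false, G; rewrite expn0 muln1; split=> //.
by rewrite -(@Gauss_dvdl _ m p) // coprime_sym prime_coprime.
Qed.

Definition squarefree (m : nat) : Prop := forall l, prime l -> ~~ (l ^ 2 %| m)%N.

Lemma squarefree_dvd m n : (m %| n)%N -> squarefree n -> squarefree m.
Proof. by move=> mn sfn l /sfn; apply: contra => lm; apply: dvdn_trans mn. Qed.

Lemma squarefree_gt0 m : squarefree m -> (0 < m)%N.
Proof. by move=> sfm; rewrite lt0n; apply: contraTneq (sfm 2%N isT) => ->. Qed.

Lemma squarefree_prod (s : seq nat) :
  all prime s -> uniq s -> squarefree (\prod_(p <- s) p)%N.
Proof.
move=> prs uniqs l prl.
have [prod_gt0 lognE] : (0 < \prod_(p <- s) p)%N /\
    logn l (\prod_(p <- s) p)%N = count_mem l s.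
  elim: s prs {uniqs} => [_|p s IHs /= /andP[prp /IHs[s_gt0 sE]]].
    by rewrite big_nil logn1.
  have p_gt0 := prime_gt0 prp; rewrite big_cons muln_gt0 p_gt0 s_gt0; split=> //.
  by rewrite (lognM _ p_gt0 s_gt0) sE logn_prime // eq_sym.
by rewrite pfactor_dvdn // lognE count_uniq_mem //; case: (l \in s).
Qed.

Lemma Crat_sqr_squarefree (m : nat) (t : algC) : squarefree m ->
  t \in Crat -> t ^+ 2 * m%:R \in Num.int -> t \in Num.int.
Proof.
move=> sfm /CratP[a ->].
rewrite -(ratr_nat algC) -rmorphXn -rmorphM /= !Cint_rat => /intrP[c cE].
have dN0 : (denq a)%:~R != 0 :> rat by rewrite intr_eq0 denq_neq0.
have eqZ : numq a ^+ 2 * m%:Z = c * denq a ^+ 2.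
  apply: (@intr_inj rat); rewrite !intrM -cE.
  have aE := divq_num_den a; move: dN0 aE; set d := (denq a)%:~R => dN0 aE.
  by rewrite -[X in X ^+ 2 * m%:R]aE; field.
have dvd2 : (`|denq a| ^ 2 %| m)%N.
  have co : coprime (`|denq a| ^ 2) (`|numq a| ^ 2).
    by rewrite coprimeXl // coprimeXr // coprime_sym coprime_num_den.
  rewrite -(Gauss_dvdr _ co) -!abszX -[m]absz_nat -abszM eqZ abszM.
  by rewrite dvdn_mull.
have den1 : `|denq a|%N = 1%N.
  apply/eqP; rewrite eqn_leq absz_gt0 denq_neq0 andbT leqNgt; apply/negP => d_gt1.
  have := sfm _ (pdiv_prime d_gt1); rewrite (dvdn_trans _ dvd2) //.
  by rewrite dvdn_exp2r // pdiv_dvd.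
have d1 : denq a = 1 by rewrite -absz_denq den1.
by rewrite -[a]divq_num_den d1 divr1 rpred_int.
Qed.

Lemma Crat_sqr_neq (n : nat) (z : algC) : squarefree n -> (1 < n)%N ->
  z \in Crat -> z ^+ 2 <> n%:R.
Proof.
move=> sfn n_gt1 zQ zE.
have /intrP[c cE] : z \in Num.int.
  by apply: Cint_rat_Aint => //; apply: Aint_sqr; rewrite zE (Aint_int n).
have nE : n = (`|c| ^ 2)%N.
  have c2 : c ^+ 2 = n%:Z by apply: (@intr_inj algC); rewrite rmorphXn /= -cE zE.
  by rewrite -abszX c2.
have c_gt1 : (1 < `|c|)%N by rewrite -(@ltn_sqr 1) -nE.
have := sfn _ (pdiv_prime c_gt1).
by rewrite nE dvdn_exp2r // pdiv_dvd.
Qed.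

Lemma int_sqr_mod4 (x : int) : exists (y z : int) (b : bool),
  x = 2 * y + b%:Z /\ x ^+ 2 = 4 * z + b%:Z.
Proof.
pose y := (x %/ 2)%Z; pose b := (x %% 2 != 0)%Z.
have xE : x = 2 * y + b%:Z.
  rewrite {1}(divz_eq x 2) mulrC; congr (_ + _); rewrite /b.
  have := ltz_pmod x (isT : 0 < 2 :> int); have := modz_ge0 x (isT : 2 != 0 :> int).
  by move: (x %% 2)%Z => [[|[|]]|].
exists y, (y ^+ 2 + y * b%:Z), b; split=> //; rewrite {1}xE.
by case: (b) => /=; ring.
Qed.

Lemma sqr_sub_mod4 (X Y m c : int) : X ^+ 2 - (4 * m + 3) * Y ^+ 2 = 4 * c ->
  exists x y : int, X = 2 * x /\ Y = 2 * y.
Proof.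
have [x [u [b [-> ->]]]] := int_sqr_mod4 X; have [y [v [d [-> ->]]]] := int_sqr_mod4 Y.
by case: b; case: d => E; try lia; exists x, y; rewrite !addr0.
Qed.

Lemma sqr_sub_neqN1 (X Y m : int) : X ^+ 2 - (4 * m + 3) * Y ^+ 2 <> -1.
Proof.
have [x [u [b [-> ->]]]] := int_sqr_mod4 X; have [y [v [d [-> ->]]]] := int_sqr_mod4 Y.
by case: b; case: d; lia.
Qed.

Lemma modn4_eq3_int m : (m %% 4 = 3)%N -> exists r : int, m%:Z = 4 * r + 3.
Proof. by exists (m %/ 4)%:Z; lia. Qed.

(** * Quadratic fields *)

Lemma sqr_sqrtC_Crat (m : nat) : sqrtC m%:R ^+ 2 \in Crat.
Proof. by rewrite sqrtCK rpred_nat. Qed.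

Lemma sqr_i_Crat : ('i : algC) ^+ 2 \in Crat.
Proof. by rewrite sqrCi rpredN rpred1. Qed.

Lemma conj_sqrtC_nat (m : nat) : (sqrtC m%:R)^* = sqrtC m%:R :> algC.
Proof. by apply/CrealP; rewrite ger0_real // sqrtC_ge0 ler0n. Qed.

Lemma sqrtC_natM (m n : nat) : sqrtC (m * n)%:R = sqrtC m%:R * sqrtC n%:R :> algC.
Proof. by rewrite natrM sqrtCM ?nnegrE ?ler0n. Qed.

Definition Gauss : set algC := Qadjoin [set 'i].

Lemma Gauss_sqr_neq (n : nat) z : squarefree n -> (1 < n)%N -> Gauss z -> z ^+ 2 <> n%:R.
Proof.
rewrite /Gauss QadjoinE => sfn n_gt1 Gz zE.
have z2Q : z ^+ 2 \in Crat by rewrite zE rpred_nat.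
have [zQ|ziQ] := adjoin_sqr_cases Crat_subfield sqr_i_Crat Gz z2Q.
  exact: (Crat_sqr_neq sfn n_gt1 zQ).
have : 0 <= (z * 'i) ^+ 2 by rewrite real_exprn_even_ge0 // Creal_Crat.
by rewrite exprMn zE sqrCi mulrN1 oppr_ge0 lern0 => /eqP n0; rewrite n0 in n_gt1.
Qed.

Lemma adjoin_sqrtC_sqr_neq F (m n : nat) : is_subfield F ->
    (forall z, F z -> z ^+ 2 <> n%:R) -> (forall z, F z -> z ^+ 2 <> (n * m)%:R) ->
  forall z, adjoin F [set sqrtC m%:R] z -> z ^+ 2 <> n%:R.
Proof.
move=> sF neq_n neq_nm z Fz zE.
have Fm : F (sqrtC m%:R ^+ 2) by rewrite sqrtCK; in_subfield.
have Fz2 : F (z ^+ 2) by rewrite zE; in_subfield.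
have [/neq_n//|/neq_nm] := adjoin_sqr_cases sF Fm Fz Fz2.
by rewrite exprMn zE sqrtCK natrM.
Qed.

Lemma exists_aut_sqrtC (m n : nat) : squarefree (m * n) -> (1 < m)%N -> (1 < n)%N ->
  exists nu : {rmorphism algC -> algC},
    [/\ nu 'i = 'i, nu (sqrtC m%:R) = sqrtC m%:R & nu (sqrtC n%:R) = - sqrtC n%:R].
Proof.
move=> sfmn m_gt1 n_gt1; have sG : is_subfield Gauss by apply: Qadjoin_subfield.
have [|nu [nus nun]] := @exists_aut_opp [:: 'i; sqrtC m%:R] _ (sqr_sqrtC_Crat n).
  have sub : Qadjoin [set` [:: 'i; sqrtC m%:R]] `<=` adjoin Gauss [set sqrtC m%:R].
    apply: Qadjoin_min; first exact: adjoin_subfield.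
    move=> z; rewrite /= !inE => /orP[]/eqP->; last exact: adjoin_gen.
    by apply: sub_adjoin; apply: Qadjoin_gen.
  move=> /sub/(adjoin_sqrtC_sqr_neq sG); apply; last by rewrite sqrtCK.
    move=> z Gz; apply: Gauss_sqr_neq => //.
    by apply: squarefree_dvd sfmn; rewrite dvdn_mull.
  by move=> z Gz; rewrite mulnC; apply: Gauss_sqr_neq => //; apply: (@ltn_mul 1 1).
by exists nu; split=> //; apply: nus; rewrite !inE eqxx ?orbT.
Qed.

(* Let m be n or -n, chosen so that A + m <> 0.  Then (A + m) delta (A - m) is the
   square of delta B, and 2 (A + m) (A + B s) is the square of A + B s + m. *)
Lemma square_mod_quad_norm F (s : algC) (delta A B n : int) :
    is_subfield F -> F s -> s ^+ 2 = delta%:~R ->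
    A ^+ 2 - delta * B ^+ 2 = n ^+ 2 -> n != 0 ->
  exists G : nat, [/\ (G%:Z %| 2 * delta * A)%Z, (G%:Z %| 2 * delta * n)%Z,
    (G%:Z %| delta * B)%Z &
    square_mod (powers (-1)) F ((A%:~R + B%:~R * s) * (2 * G%:R))].
Proof.
move=> sF Fs s2 nE nN0.
have [m [mE m2 AmN0]] : exists m, [/\ m = n \/ m = - n, m ^+ 2 = n ^+ 2 & A + m != 0].
  have [An0|AnN0] := eqVneq (A + n) 0; last by exists n; split=> //; left.
  exists (- n); rewrite sqrrN; split=> //; first by right.
  have -> : A = - n by apply/eqP; rewrite -addr_eq0 An0.
  by rewrite -opprD oppr_eq0 -mulr2n mulrn_eq0.
have [|G [c [e [AmE G1 G2 G3]]]] :=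
  @mul_eq_sqr_gcd (A + m) (delta * (A - m)) (delta * B) _ AmN0.
  transitivity (delta * (A ^+ 2 - m ^+ 2)); first by ring.
  by rewrite m2 -nE; ring.
have dG : (G%:Z %| delta * (A + m))%Z by apply: dvdz_mull.
exists G; split=> //.
- have -> : 2 * delta * A = delta * (A + m) + delta * (A - m) by ring.
  exact: rpredD.
- have : (G%:Z %| 2 * delta * m)%Z.
    have -> : 2 * delta * m = delta * (A + m) - delta * (A - m) by ring.
    exact: rpredB.
  by case: mE => -> //; rewrite mulrN rpredN.
set w := A%:~R + _; have sU := powersN1_subgroup.
pose w' : algC := A%:~R - B%:~R * s.
have ww' : w * w' = m%:~R ^+ 2.
  rewrite -rmorphXn /= m2 -nE rmorphB /= [X in _ = _ - X]intrM !rmorphXn /= -s2.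
  by rewrite /w /w'; ring.
have trE : w + w' + 2 * m%:~R = 2 * (A + m)%:~R by rewrite intrD /w /w'; ring.
have Am : (A + m)%:~R = (-1) ^+ e * c%:~R ^+ 2 * G%:R :> algC.
  by rewrite AmE intrM rmorph_sign [X in _ * X]intrM rmorphXn /= -pmulrn; ring.
have cN0 : c%:~R != 0 :> algC.
  by rewrite intr_eq0; apply: contraNneq AmN0 => c0; rewrite AmE c0 expr0n !mulr0.
have /(mul_subgroup_cancel (square_mod_subgroup sU sF)) : square_mod (powers (-1)) F
    ((-1) ^+ e * c%:~R ^+ 2 * (w * (2 * G%:R))).
  have -> : (-1) ^+ e * c%:~R ^+ 2 * (w * (2 * G%:R)) = w * (w + w' + 2 * m%:~R).
    by rewrite trE Am; ring.
  apply: (square_mod_norm sU sF _ _ _ _ ww'); try by rewrite /w; in_subfield.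
    apply: contraNneq nN0 => w0; move/eqP: ww'; rewrite w0 mul0r eq_sym sqrf_eq0 intr_eq0.
    by rewrite -sqrf_eq0 m2 sqrf_eq0.
  by rewrite trE mulf_neq0 ?intr_eq0 ?pnatr_eq0.
by apply; exists ((-1) ^+ e), c%:~R; split=> //; [apply: powersX | in_subfield].
Qed.

Lemma Crat_unit c : c \in Crat -> c != 0 -> c \in Aint -> c^-1 \in Aint ->
  c = 1 \/ c = -1.
Proof.
move=> cQ cN0 cA cVA.
have /intrP[a aE] : c \in Num.int by apply: Cint_rat_Aint.
have /intrP[b bE] : c^-1 \in Num.int by apply: Cint_rat_Aint; rewrite ?rpredV.
have ab1 : a * b = 1.
  by apply: (@intr_inj algC); rewrite intrM -aE -bE mulfV.
rewrite aE; have : a \is a GRing.unit by apply/unitrP; exists b; rewrite ab1 mulrC ab1.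
by rewrite qualifE /= => /orP[]/eqP->; [left | right; rewrite mulrN1z].
Qed.

Section QuadraticField.

Variables (m : nat) (nu : {rmorphism algC -> algC}).
Let s : algC := sqrtC m%:R.
Hypothesis nus : nu s = - s.

Lemma quadfieldP z :
  quadfield m z <-> exists a b, [/\ a \in Crat, b \in Crat & z = a + b * s].
Proof. exact: Qadjoin_sqrtP (sqr_sqrtC_Crat m). Qed.

Lemma quad_conjE a b : a \in Crat -> b \in Crat -> nu (a + b * s) = a - b * s.
Proof. by move=> aQ bQ; rewrite rmorphD rmorphM nus !aut_Crat // mulrN. Qed.

Lemma has_quad_norm_conj z r : has_quad_norm m z r -> z * nu z = ratr r.
Proof.
move=> [a [b [-> ->]]]; rewrite -/s quad_conjE ?Crat_rat //.
rewrite rmorphB [X in _ = _ - X]rmorphM !rmorphXn /= ratr_nat.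
by rewrite -[m%:R]sqrtCK -/s; ring.
Qed.

Lemma quad_unit_norm u : is_unit (quadfield m) u -> u * nu u = 1 \/ u * nu u = -1.
Proof.
move=> [[/quadfieldP[a [b [aQ bQ uE]]] Au] uN0 [_ AuV]]; apply: Crat_unit.
- rewrite uE quad_conjE //.
  have -> : (a + b * s) * (a - b * s) = a ^+ 2 - b ^+ 2 * s ^+ 2 by ring.
  by rewrite sqrtCK rpredB ?rpredM ?rpredX ?rpred_nat.
- by rewrite mulf_neq0 ?fmorph_eq0.
- by rewrite rpredM ?Aint_aut.
- by rewrite invfM -fmorphV rpredM ?Aint_aut.
Qed.

Hypothesis sfm : squarefree m.

Lemma quad_coord_double_int a b : a \in Crat -> b \in Crat -> a + b * s \in Aint ->
  2 * a \in Num.int /\ 2 * b \in Num.int.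
Proof.
move=> aQ bQ Az; have Az' : a - b * s \in Aint by rewrite -quad_conjE // Aint_aut.
split.
  apply: Cint_rat_Aint; first by rewrite rpredM ?rpred_nat.
  have -> : 2 * a = (a + b * s) + (a - b * s) by ring.
  by rewrite rpredD.
apply: (Crat_sqr_squarefree sfm); first by rewrite rpredM ?rpred_nat.
apply: Cint_rat_Aint; first by rewrite rpredM ?rpred_nat ?rpredX ?rpredM ?rpred_nat.
have -> : (2 * b) ^+ 2 * m%:R = ((a + b * s) - (a - b * s)) ^+ 2.
  by rewrite -[m%:R]sqrtCK -/s; ring.
by rewrite rpredX // rpredB.
Qed.

Hypothesis m3 : (m %% 4 = 3)%N.

Lemma ringint_quadfield z : ringint (quadfield m) z ->
  exists x y : int, z = x%:~R + y%:~R * s.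
Proof.
move=> [/quadfieldP[a [b [aQ bQ zE]]] Az]; rewrite zE in Az *.
have [/intrP[X XE] /intrP[Y YE]] := quad_coord_double_int aQ bQ Az.
have [r mE] := modn4_eq3_int m3.
have /intrP[c cE] : a ^+ 2 - b ^+ 2 * s ^+ 2 \in Num.int.
  apply: Cint_rat_Aint; first by rewrite sqrtCK rpredB ?rpredM ?rpredX ?rpred_nat.
  have -> : a ^+ 2 - b ^+ 2 * s ^+ 2 = (a + b * s) * nu (a + b * s).
    by rewrite quad_conjE //; ring.
  by rewrite rpredM ?Aint_aut.
have [|x [y [XE' YE']]] := @sqr_sub_mod4 X Y r c.
  rewrite -mE; apply: (@intr_inj algC).
  rewrite rmorphB [X in _ - X = _]rmorphM !rmorphXn /= -XE -YE.
  rewrite [RHS]intrM -cE -pmulrn sqrtCK.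
  by ring.
have n2 : 2 != 0 :> algC by rewrite pnatr_eq0.
exists x, y; congr (_ + _ * _); apply: (mulfI n2).
  by rewrite XE XE' intrM.
by rewrite YE YE' intrM.
Qed.

Lemma quad_unit_coord (x y : int) : is_unit (quadfield m) (x%:~R + y%:~R * s) ->
  x ^+ 2 - m%:Z * y ^+ 2 = 1.
Proof.
have [r mE] := modn4_eq3_int m3; move/quad_unit_norm.
have -> : (x%:~R + y%:~R * s) * nu (x%:~R + y%:~R * s) = (x ^+ 2 - m%:Z * y ^+ 2)%:~R.
  rewrite quad_conjE ?rpred_int // rmorphB [X in _ = _ - X]rmorphM !rmorphXn /= -pmulrn.
  by rewrite -[m%:R]sqrtCK -/s; ring.
case=> [/(intr_inj (x2 := 1))//|]; rewrite -[-1](mulrN1z 1) => /intr_inj.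
by rewrite mE => /sqr_sub_neqN1.
Qed.

Lemma quad_unit_sqr_class u : prime m -> is_unit (quadfield m) u ->
  exists j : bool, square_mod (powers (-1)) (quadfield m) (u * 2 ^+ j).
Proof.
move=> pm uU; have [Ou _ _] := uU.
have [x [y uE]] := ringint_quadfield Ou; rewrite uE in uU *.
have sF : is_subfield (quadfield m) by apply: Qadjoin_subfield.
have Fs : quadfield m s by apply: Qadjoin_gen.
have s2 : s ^+ 2 = m%:Z%:~R by rewrite sqrtCK.
have sU := powersN1_subgroup.
have sT := square_mod_subgroup sU sF.
have [|//|G [_ Gm _ uG]] := @square_mod_quad_norm _ s m x y 1 sF Fs s2.
  by rewrite expr1n; apply: quad_unit_coord uU.
have [r [G0 [G02 GE]]] : exists (r : bool) (G0 : nat), (G0 %| 2)%N /\ G = (G0 * m ^ r)%N.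
  by apply: dvdn_mul_prime_split => //; rewrite mulr1 -PoszM in Gm.
have uG0 : square_mod (powers (-1)) (quadfield m) ((x%:~R + y%:~R * s) * (2 * G0%:R)).
  apply: (mul_subgroup_cancel sT (u := (s ^+ r) ^+ 2)); last first.
    apply: square_mod_sqr; rewrite ?expf_neq0 //; first by in_subfield.
    by rewrite sqrtC_eq0 pnatr_eq0 -lt0n prime_gt0.
  move: uG; rewrite GE natrM natrX -[m%:R]sqrtCK -/s exprAC; congr square_mod; ring.
have G0_le2 := dvdn_leq (isT : 0 < 2)%N G02.
case: G0 G02 G0_le2 uG0 {GE} => [|[|[|//]]] // _ _ uG0.
  by exists true; rewrite expr1; rewrite mulr1 in uG0.
exists false; rewrite mulr1; apply: (mul_subgroup_cancel sT (u := 2 ^+ 2)).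
  by rewrite mulrC expr2.
by apply: square_mod_sqr; [exact: sU | in_subfield | rewrite pnatr_eq0].
Qed.

End QuadraticField.

Lemma fundamental_unit_norm1_sqr (m : nat) (nu : {rmorphism algC -> algC}) eps u :
    nu (sqrtC m%:R) = - sqrtC m%:R -> is_fundamental_unit m eps ->
    has_quad_norm m eps (-1) -> is_unit (quadfield m) u -> u * nu u = 1 ->
  exists (w : algC) (n : int), powers (-1) w /\ u = w * (eps ^ n) ^+ 2.
Proof.
move=> nus [[_ epsN0 _] _ gen] /(has_quad_norm_conj nus) eps_norm uU uN.
have [w [n [w1 uE]]] : exists w n, (w = 1 \/ w = -1) /\ u = w * eps ^ n.
  have [n [->|->]] := gen u uU.
    by exists 1, n; rewrite mul1r; split=> //; left.
  by exists (-1), n; rewrite mulN1r; split=> //; right.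
have [y [z [b [nE _]]]] := int_sqr_mod4 n.
exists w, y; split; first exact/powersN1P.
have expE (a : algC) : a != 0 -> a ^ n = a ^+ b * (a ^ y) ^+ 2.
  by move=> aN0; rewrite nE expfzDr // mulrC (mulrC 2) -exprz_exp.
suff b0 : b = false by rewrite uE expE // b0 mul1r.
have w2 : w * nu w = 1.
  by case: w1 => ->; rewrite ?rmorphN rmorph1 ?mulrNN mulr1.
move: uN; rewrite uE rmorphM mulrACA w2 mul1r fmorphXz -expfzMl eps_norm.
rewrite rmorphN1 expE ?oppr_eq0 ?oner_eq0 //.
have -> : ((-1) ^ y) ^+ 2 = 1 :> algC.
  by have [|->|->] := (powersN1P ((-1) ^ y)).1; rewrite ?sqrrN ?expr1n //; exists y.
by rewrite mulr1 => /(@signr_inj _ b false).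
Qed.

(** * Units of Q(i, sqrt q, sqrt P) *)

Lemma Qadjoin_sqrt_fixed (s z : algC) (nu : {rmorphism algC -> algC}) :
  s ^+ 2 \in Crat -> nu s = - s -> Qadjoin [set s] z -> nu z = z -> z \in Crat.
Proof.
rewrite QadjoinE => s2 nus.
have [|_ _ _] := adjoin_sqrt_quad_conj Crat_subfield s2 _ nus; last exact.
exact: aut_Crat.
Qed.

Lemma biquadratic_real_fixed (s t z : algC) (nu : {rmorphism algC -> algC}) :
    s ^+ 2 \in Crat -> t ^+ 2 \in Crat -> s^* = s -> t^* = t -> nu s = s -> nu t = - t ->
    Qadjoin [set 'i; s; t] z -> z^* = z -> nu z = z ->
  Qadjoin [set s] z.
Proof.
move=> s2 t2 sR tR nus nut Kz zR nuz.
have sF := Qadjoin_subfield [set s]; have sL := adjoin_subfield (Qadjoin [set s]) [set t].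
have fixQ (mu : {rmorphism algC -> algC}) :
    mu s = s -> forall w, Qadjoin [set s] w -> mu w = w.
  by move=> mus; apply: adjoin_rmorph_id => // _ ->.
have Lz : adjoin (Qadjoin [set s]) [set t] z.
  have [|||_ _ _] := @adjoin_sqrt_quad_conj _ 'i Num.conj sL.
  - exact: subfield_Crat sqr_i_Crat.
  - by apply: adjoin_rmorph_id => [w|_ -> //]; apply: fixQ.
  - exact: conjCi.
  apply=> //; have sM := adjoin_subfield (adjoin (Qadjoin [set s]) [set t]) [set 'i].
  move: z Kz {zR nuz}; apply: Qadjoin_min => // _ [[->|->]|->].
  - exact: adjoin_gen.
  - by do 2!apply: sub_adjoin; apply: Qadjoin_gen.
  - by apply: sub_adjoin; apply: adjoin_gen.
have [|||_ _ _] := @adjoin_sqrt_quad_conj (Qadjoin [set s]) t nu sF; last exact.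
- exact: subfield_Crat t2.
- exact: fixQ.
- exact: nut.
Qed.

Lemma multiquadratic_real_norm_unit (m n : nat) (nu : {rmorphism algC -> algC})
    (K := Qadjoin [set 'i; sqrtC m%:R; sqrtC n%:R]) r :
    nu (sqrtC m%:R) = sqrtC m%:R -> nu (sqrtC n%:R) = - sqrtC n%:R ->
    is_unit K r -> r^* = r -> is_unit (quadfield m) (r * nu r).
Proof.
move=> num nun [[Kr Ar] rN0 [_ AVr]] rR.
have sqrS x : [set 'i; sqrtC m%:R; sqrtC n%:R] x -> x ^+ 2 \in Crat.
  by move=> [[->|->]|->]; rewrite ?sqr_i_Crat ?sqr_sqrtC_Crat.
have sK : is_subfield K by apply: Qadjoin_subfield.
have Knr := multiquadratic_aut sqrS nu Kr.
have Fu : quadfield m (r * nu r).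
  apply: (biquadratic_real_fixed (sqr_sqrtC_Crat m) (sqr_sqrtC_Crat n)) num nun _ _ _.
  - exact: conj_sqrtC_nat.
  - exact: conj_sqrtC_nat.
  - by in_subfield.
  - by rewrite rmorphM /= -(multiquadratic_autC sqrS nu Num.conj Kr) /= rR.
  - by rewrite rmorphM (multiquadratic_autK sqrS nu Kr) mulrC.
have sF : is_subfield (quadfield m) by apply: Qadjoin_subfield.
split; [by split; rewrite // rpredM ?Aint_aut | by rewrite mulf_neq0 ?fmorph_eq0 |].
by split; [in_subfield | rewrite invfM -fmorphV rpredM ?Aint_aut].
Qed.

Lemma imag_quad_unit_torsion u :
  u \in Aint -> u * u^* = 1 -> u + u^* \in Crat -> u ^+ 12 = 1.
Proof.
move=> Au uu trQ.
have /intrP[c cE] : u + u^* \in Num.int.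
  by apply: Cint_rat_Aint => //; rewrite rpredD ?(Aint_aut Num.conj).
have u2 : u ^+ 2 = c%:~R * u - 1 by rewrite -cE -uu; ring.
have norm_u : `|u| = 1 by apply/eqP; rewrite -sqrp_eq1 // normCK uu.
have c_le2 : `|c| <= 2.
  rewrite -(ler_int algC) intr_norm -cE (le_trans (ler_normD _ _)) //.
  by rewrite norm_conjC norm_u.
have u3 : u ^+ 3 = u * (c%:~R * u - 1) by rewrite -u2; ring.
have [c0|[c1|[c1|[c2|c2]]]] : c = 0 \/ c = 1 \/ c = -1 \/ c = 2 \/ c = -2.
  by move: c_le2; lia.
- by rewrite (exprM u 2 6) u2 c0 mul0r sub0r -signr_odd.
- rewrite (exprM u 3 4) u3 c1 mul1r mulrBr mulr1 -expr2 u2 c1 mul1r.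
  by rewrite addrAC subrr add0r -signr_odd.
- rewrite (exprM u 3 4) u3 c1 mulN1r mulrBr mulr1 mulrN -expr2 u2 c1 mulN1r.
  by rewrite opprB opprK addrK expr1n.
- have /eqP : (u - 1) ^+ 2 = 0.
    by transitivity (u ^+ 2 - 2 * u + 1); [ring | rewrite u2 c2; ring].
  by rewrite sqrf_eq0 subr_eq0 => /eqP->; rewrite expr1n.
- have /eqP : (u + 1) ^+ 2 = 0.
    by transitivity (u ^+ 2 + 2 * u + 1); [ring | rewrite u2 c2; ring].
  by rewrite sqrf_eq0 addr_eq0 => /eqP->; rewrite -signr_odd.
Qed.

Lemma rel_norm1_expr4 (sg : {rmorphism algC -> algC}) (x : algC) :
  sg 'i = 'i -> x ^+ 4 = 1 -> x * sg x = 1 -> x ^+ 2 = 1.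
Proof.
move=> sgi x4 xsx; have /eqP : (x ^+ 2) ^+ 2 = 1 by rewrite -exprM.
rewrite sqrf_eq1 => /orP[/eqP//|]; rewrite -(sqrCi algC) eqf_sqr => xE.
have sgx : sg x = x by case/orP: xE => /eqP->; rewrite ?rmorphN sgi.
by rewrite expr2 -{2}sgx.
Qed.

Lemma multiquadratic_sqr_neq (m n r : nat) z : squarefree (r * (m * n)) ->
    (0 < m)%N -> (0 < n)%N -> (1 < r)%N ->
  Qadjoin [set 'i; sqrtC m%:R; sqrtC n%:R] z -> z ^+ 2 <> r%:R.
Proof.
move=> sf m_gt0 n_gt0 r_gt1.
have sG : is_subfield Gauss by apply: Qadjoin_subfield.
have GaussN k w : (k %| m * n)%N -> (0 < k)%N -> Gauss w -> w ^+ 2 <> (r * k)%:R.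
  move=> kmn k_gt0; apply: Gauss_sqr_neq; last by rewrite (leq_trans r_gt1) ?leq_pmulr.
  by apply: squarefree_dvd sf; rewrite dvdn_pmul2l // ltnW.
have sL := adjoin_subfield Gauss [set sqrtC m%:R].
have sub : Qadjoin [set 'i; sqrtC m%:R; sqrtC n%:R] `<=`
    adjoin (adjoin Gauss [set sqrtC m%:R]) [set sqrtC n%:R].
  apply: Qadjoin_min; first exact: adjoin_subfield.
  move=> _ [[->|->]|->]; last exact: adjoin_gen.
    by do 2!apply: sub_adjoin; apply: Qadjoin_gen.
  by apply: sub_adjoin; apply: adjoin_gen.
move=> /sub; move: z; apply: (adjoin_sqrtC_sqr_neq sL);
  apply: (adjoin_sqrtC_sqr_neq sG) => w.
- by rewrite -[r]muln1; apply: GaussN.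
- by apply: GaussN; rewrite ?dvdn_mulr.
- by apply: GaussN; rewrite ?dvdn_mull.
- by rewrite -mulnA (mulnC n); apply: GaussN; rewrite // muln_gt0 m_gt0.
Qed.

Section OcticField.

Variables (q P : nat) (tau1 tau2 sg : {rmorphism algC -> algC}).
Let s : algC := sqrtC q%:R.
Let t : algC := sqrtC P%:R.
Let K : set algC := Qadjoin [set 'i; s; t].

Hypotheses (tau1i : tau1 'i = 'i) (tau1q : tau1 s = s) (tau1P : tau1 t = - t).
Hypotheses (tau2i : tau2 'i = 'i) (tau2P : tau2 t = t) (tau2q : tau2 s = - s).
Hypothesis sgE : forall z, sg z = tau1 (tau2 z).

Let sgi : sg 'i = 'i. Proof. by rewrite sgE tau2i tau1i. Qed.
Let sgq : sg s = - s. Proof. by rewrite sgE tau2q rmorphN tau1q. Qed.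
Let sgP : sg t = - t. Proof. by rewrite sgE tau2P tau1P. Qed.

Let sK : is_subfield K. Proof. exact: Qadjoin_subfield. Qed.
Let Ki : K 'i. Proof. by apply: Qadjoin_gen; left; left. Qed.

Let sqrS x : [set 'i; s; t] x -> x ^+ 2 \in Crat.
Proof. by move=> [[->|->]|->]; rewrite ?sqr_i_Crat ?sqr_sqrtC_Crat. Qed.

Let autK (nu : {rmorphism algC -> algC}) z : K z -> K (nu z).
Proof. exact: multiquadratic_aut. Qed.

Let aut_inv (nu : {rmorphism algC -> algC}) z : K z -> nu (nu z) = z.
Proof. exact: multiquadratic_autK. Qed.

Let aut_comm (nu mu : {rmorphism algC -> algC}) z : K z -> nu (mu z) = mu (nu z).
Proof. exact: multiquadratic_autC. Qed.

Let KC : K = Qadjoin [set 'i; t; s]. Proof. by rewrite /K setUAC. Qed.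

Let rational_tau1 z : K z -> z^* = z -> tau1 z = z -> sg z = z -> z \in Crat.
Proof.
move=> Kz zR z1; apply: (Qadjoin_sqrt_fixed (sqr_sqrtC_Crat q) sgq).
have fixed := biquadratic_real_fixed (sqr_sqrtC_Crat q) (sqr_sqrtC_Crat P).
by apply: fixed tau1q tau1P Kz zR z1; apply: conj_sqrtC_nat.
Qed.

Let rational_tau2 z : K z -> z^* = z -> tau2 z = z -> sg z = z -> z \in Crat.
Proof.
rewrite KC => Kz zR z2; apply: (Qadjoin_sqrt_fixed (sqr_sqrtC_Crat P) sgP).
have fixed := biquadratic_real_fixed (sqr_sqrtC_Crat P) (sqr_sqrtC_Crat q).
by apply: fixed tau2P tau2q Kz zR z2; apply: conj_sqrtC_nat.
Qed.

(* z nu(z) is a unit of absolute value 1 in an imaginary quadratic field. *)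
Let norm1_torsion (nu : {rmorphism algC -> algC}) z :
    (forall w, K w -> w^* = w -> nu w = w -> sg w = w -> w \in Crat) ->
    K z -> z \in Aint -> z * z^* = 1 -> z * sg z = 1 ->
  (z * nu z) ^+ 6 = 1.
Proof.
move=> rational_nu Kz Az zz zsz; set u := z * nu z.
have Ku : K u by have := autK nu Kz => ?; rewrite /u; in_subfield.
have Kuc : K u^* by apply: (autK Num.conj).
have Au : u \in Aint by rewrite rpredM ?Aint_aut.
have uu : u * u^* = 1.
  rewrite rmorphM /= -[(nu z)^*](aut_comm nu Num.conj Kz) /= mulrACA zz.
  by rewrite -rmorphM zz rmorph1 mulr1.
have usu : u * sg u = 1.
  by rewrite rmorphM -(aut_comm nu sg Kz) mulrACA zsz -rmorphM zsz rmorph1 mulr1.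
have uN0 : u != 0.
  by apply: contraTneq isT => u0; move/eqP: uu; rewrite u0 mul0r eq_sym oner_eq0.
have sgu : sg u = u^* by apply: (mulfI uN0); rewrite usu uu.
have nuu : nu u = u by rewrite rmorphM (aut_inv nu Kz) mulrC.
have u12 : u ^+ 12 = 1.
  apply: imag_quad_unit_torsion => //; apply: rational_nu; first by in_subfield.
  - by rewrite rmorphD /= conjCK addrC.
  - by rewrite rmorphD (aut_comm nu Num.conj Ku) /= nuu.
  - by rewrite rmorphD (aut_comm sg Num.conj Ku) /= sgu conjCK addrC.
rewrite (exprM u 3 2); apply: (rel_norm1_expr4 sgi); first by rewrite -exprM.
by rewrite rmorphXn -exprMn usu expr1n.
Qed.

Lemma octic_unit_torsion z : K z -> z \in Aint -> z * z^* = 1 -> z * sg z = 1 ->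
  z ^+ 6 = 1.
Proof.
move=> Kz Az zz zsz.
have z2 : z ^+ 2 = (z * tau1 z) * (z * tau2 z).
  have : tau1 (z * sg z) = 1 by rewrite zsz rmorph1.
  rewrite rmorphM sgE (aut_inv tau1 (autK tau2 Kz)) => t12.
  by rewrite -[LHS]mulr1 -t12; ring.
have z12 : z ^+ 12 = 1.
  rewrite (exprM z 2 6) z2 exprMn.
  by rewrite (norm1_torsion rational_tau1) // (norm1_torsion rational_tau2) // mulr1.
rewrite (exprM z 3 2); apply: (rel_norm1_expr4 sgi); first by rewrite -exprM.
by rewrite rmorphXn -exprMn zsz expr1n.
Qed.

Hypotheses (pq : prime q) (q3 : (q %% 4 = 3)%N) (P_gt0 : (0 < P)%N).
Hypothesis sf : squarefree (2 * (P * q)).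

Variable eps : algC.
Hypotheses (eps_fund : is_fundamental_unit P eps) (eps_norm : has_quad_norm P eps (-1)).

Let sfq : squarefree q.
Proof. by apply: squarefree_dvd sf; rewrite mulnA dvdn_mull. Qed.

Let q_gt0 : (0 < q)%N. Proof. exact: prime_gt0. Qed.

Let quadfield_qK : quadfield q `<=` K.
Proof. by apply: Qadjoin_min => // _ ->; apply: Qadjoin_gen; left; right. Qed.

Let quadfield_PK : quadfield P `<=` K.
Proof. by apply: Qadjoin_min => // _ ->; apply: Qadjoin_gen; right. Qed.

Lemma fundamental_unit_octic : is_unit K eps.
Proof. by apply: (is_unit_sub quadfield_PK); case: eps_fund. Qed.

Let real_quadfield m z : quadfield m z -> z^* = z.
Proof.
by apply: (@adjoin_rmorph_id _ _ Num.conj) => // _ ->; apply: conj_sqrtC_nat.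
Qed.

Let eps_real (n : int) : (eps ^ n)^* = eps ^ n.
Proof.
by rewrite (fmorphXz Num.conj) /= (@real_quadfield P) //; case: eps_fund => -[[]].
Qed.

(* r tau1(r) = +-2^j c^2 in Q(sqrt q) and r tau2(r) = +-eps^(2n) in Q(sqrt P), whereas their
   product is +-r^2. *)
Lemma octic_real_unit_sqr r : is_unit K r -> r^* = r -> powers (-1) (r * sg r) ->
  exists u v c (n : int) (j : bool), [/\ powers (-1) u, powers (-1) v, quadfield q c,
    r * tau1 r * 2 ^+ j = u * c ^+ 2 & (c * eps ^ n) ^+ 2 = v * 2 ^+ j * r ^+ 2].
Proof.
move=> rU rR rsr; have [[Kr Ar] rN0 [_ AVr]] := rU.
have tau12 : tau1 r * tau2 r = r * sg r.
  have -> : tau1 r * tau2 r = tau1 (r * sg r).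
    by rewrite sgE rmorphM (aut_inv tau1 (autK tau2 Kr)).
  by case/powersN1P: rsr => ->; rewrite ?rmorphN rmorph1.
have uqU := multiquadratic_real_norm_unit tau1q tau1P rU rR.
have uPU : is_unit (quadfield P) (r * tau2 r).
  by apply: (multiquadratic_real_norm_unit tau2P tau2q); rewrite // -/s -/t -KC.
have uPN : (r * tau2 r) * tau1 (r * tau2 r) = 1.
  transitivity (r * sg r * (tau1 r * tau2 r)); first by rewrite rmorphM sgE; ring.
  by rewrite tau12 -expr2; case/powersN1P: rsr => ->; rewrite ?sqrrN expr1n.
have [u2 [n [u2E uPE]]] := fundamental_unit_norm1_sqr tau1P eps_fund eps_norm uPU uPN.
have [j [u1 [c [u1E Qc _ uqE]]]] := quad_unit_sqr_class tau2q sfq q3 pq uqU.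
exists u1, (r * sg r / (u1 * u2)), c, n, j; split=> //.
  by apply: (mul_subgroup_div powersN1_subgroup) => //;
    apply: (mul_subgroupM powersN1_subgroup).
have u1N0 := mul_subgroup_neq0 powersN1_subgroup u1E.
have u2N0 := mul_subgroup_neq0 powersN1_subgroup u2E.
transitivity ((u1 * c ^+ 2) * (u2 * (eps ^ n) ^+ 2) / (u1 * u2)).
  by field; apply/andP.
by rewrite -uqE -uPE -tau12; ring.
Qed.

(* Otherwise c eps^n / r would be a square root of 2 in K. *)
Lemma octic_real_unit r : is_unit K r -> r^* = r -> powers (-1) (r * sg r) ->
  exists w c (n : int), [/\ powers (-1) w, is_unit (quadfield q) c & r = w * c * eps ^ n].
Proof.
move=> rU rR rsr; have [[Kr Ar] rN0 _] := rU; have sQ := Qadjoin_subfield [set s].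
have [u [v [c [n [j [u1 v1 Qc uqE ceE]]]]]] := octic_real_unit_sqr rU rR rsr.
have Kc := quadfield_qK Qc; have [[Keps _] epsN0 _] := fundamental_unit_octic.
pose w := c * eps ^ n / r; have Kw : K w by rewrite /w; in_subfield.
have wR : w^* = w by rewrite fmorph_div rmorphM /= rR eps_real (real_quadfield Qc).
have w2 : w ^+ 2 = v * 2 ^+ j by rewrite expr_div_n ceE mulfK ?expf_neq0.
have v_eq1 : v = 1.
  have : 0 <= w ^+ 2 by rewrite expr2 -{2}wR mul_conjC_ge0.
  case/powersN1P: v1 w2 => // -> ->.
  by rewrite mulN1r oppr_ge0 lt_geF // exprn_gt0 // ltr0n.
have j0 : j = false.
  case: j w2 {uqE ceE} => //; rewrite v_eq1 mul1r => w2.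
  by case: (multiquadratic_sqr_neq _ q_gt0 P_gt0 _ Kw w2); rewrite // (mulnC q).
rewrite {}j0 {}v_eq1 in uqE w2.
have w1 : powers (-1) w.
  apply/powersN1P; move/eqP: w2.
  by rewrite mulr1 sqrf_eq1 => /orP[]/eqP; [left | right].
have wN0 := mul_subgroup_neq0 powersN1_subgroup w1.
exists w^-1, c, n; split; first exact: (mul_subgroupV powersN1_subgroup).
  apply: is_unit_sqr => //; have uN0 := mul_subgroup_neq0 powersN1_subgroup u1.
  have -> : c ^+ 2 = r * tau1 r / u by rewrite -[r * _]mulr1 uqE mulrC mulKf.
  apply: (mul_subgroup_div (is_unit_subgroup sQ)).
    exact: multiquadratic_real_norm_unit tau1q tau1P rU rR.
  case/powersN1P: u1 => ->; first exact: mul_subgroup1 (is_unit_subgroup sQ).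
  by split; rewrite ?invrN1 ?oppr_eq0 ?oner_eq0 // -(mulrN1z 1); in_ringint.
by rewrite /w invf_div -mulrA divfK //; apply: contraNneq wN0 => ce0; rewrite /w ce0 mul0r.
Qed.

Let square_mod_i z : powers 'i z -> square_mod (powers 'i) K z.
Proof. exact: square_mod_unit. Qed.

Let sT : mul_subgroup (square_mod (powers 'i) K).
Proof. by apply: square_mod_subgroup => //; apply: powers_i_subgroup. Qed.

Lemma octic_real_unit_class r : is_unit K r -> r^* = r -> powers (-1) (r * sg r) ->
  exists n, square_mod (powers 'i) K (r * eps ^+ n).
Proof.
move=> rU rR rsr; have [w [c [n [w1 cU ->]]]] := octic_real_unit rU rR rsr.
have sU := powers_i_subgroup.
have [[Keps _] epsN0 _] := fundamental_unit_octic.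
exists `|n|%N; rewrite -mulrA; apply: (mul_subgroupM sT); last exact: square_mod_exp_absz.
apply: (mul_subgroupM sT); first by apply/square_mod_i/powersN1_i.
have [j cj] := quad_unit_sqr_class tau2q sfq q3 pq cU.
have := square_mod_sub powersN1_i quadfield_qK cj; rewrite mulrC.
move/(mul_subgroup_cancel sT); apply; apply: (mul_subgroupX sT).
by apply: square_mod_2 => //; apply: powersX.
Qed.

(* With z = eta / conj(eta) one has z^3 = (-1)^e, so that r = i^e eta z is real. *)
Lemma octic_unit_class eta : is_unit K eta -> eta * sg eta = 1 ->
  exists n, square_mod (powers 'i) K (eta * eps ^+ n).
Proof.
move=> etaU ese; have [[Ke Ae] eN0 [_ AeV]] := etaU; have sUK := is_unit_subgroup sK.
have Kec := autK Num.conj Ke; have ecN0 : eta^* != 0 by rewrite conjC_eq0.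
pose z := eta / eta^*.
have zU : is_unit K z.
  apply: (mul_subgroup_div sUK) => //; split=> //.
    by split; rewrite ?(Aint_aut Num.conj).
  by split; [in_subfield | rewrite -(fmorphV Num.conj) (Aint_aut Num.conj)].
have [[Kz Az] zN0 _] := zU.
have zz : z * z^* = 1 by rewrite /z fmorph_div /= conjCK; field; apply/andP.
have zsz : z * sg z = 1.
  rewrite fmorph_div mulrACA ese -invfM [sg _](aut_comm sg Num.conj Ke) /=.
  by rewrite -(rmorphM Num.conj) ese rmorph1 invr1 mulr1.
have /eqP : (z ^+ 3) ^+ 2 = 1 by rewrite -exprM octic_unit_torsion.
rewrite sqrf_eq1 => z3; have [e z3E] : exists e : bool, z ^+ 3 = (-1) ^+ e.
  by case/orP: z3 => /eqP->; [exists false | exists true].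
have i2 := sqrCi algC; pose r := 'i ^+ e * (eta * z).
have rU : is_unit K r.
  by do 2?[apply: (mul_subgroupM sUK) => //]; apply: (mul_subgroupX sUK); apply: is_unit_i.
have rR : r^* = r.
  have zcE : z^* = z^-1 by apply: (mulfI zN0); rewrite zz mulfV.
  have ecE : eta^* = eta / z by rewrite /z invf_div mulrC divfK.
  have ezcE : (eta * z)^* = eta / z * z^-1 by rewrite -ecE -zcE -rmorphM.
  by rewrite /r rmorphM rmorphXn /= conjCi ezcE exprNn -z3E; field.
have rsr : powers (-1) (r * sg r).
  have -> : r * sg r = ('i ^+ 2) ^+ e * ((eta * sg eta) * (z * sg z)).
    by rewrite exprAC /r !rmorphM rmorphXn sgi; ring.
  by rewrite ese zsz !mulr1 i2; apply: powersX.
have [n rn] := octic_real_unit_class rU rR rsr; exists n.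
have [Kr rN0] : K r /\ r != 0 by case: rU => -[].
have sU := powers_i_subgroup.
apply: (square_mod_trans sU sK Kr rN0 _ rn).
have -> : eta * r = 'i ^+ e * (z ^+ 3) * (eta / z) ^+ 2 by rewrite /r; field.
apply: (mul_subgroupM sT); last first.
  by apply: square_mod_sqr; rewrite ?mulf_neq0 ?invr_eq0 //; in_subfield.
apply: square_mod_i; rewrite z3E; apply: (mul_subgroupM sU); first exact: powersX.
by apply: powersN1_i; apply: powersX.
Qed.

End OcticField.

(** * Square classes of Gaussian integers and of the fundamental unit *)

(* (u + 2i)(c + di) = A + Bi has norm (P v)^2, and any common divisor of 2A and B divides
   4P = 2cB - 2dA. *)
Lemma Gauss_square_class (p1 p2 : nat) (c d u v : int) :
    prime p1 -> prime p2 -> c ^+ 2 + d ^+ 2 = (p1 * p2)%N ->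
    u ^+ 2 + 4 = (p1 * p2)%N%:Z * v ^+ 2 ->
  exists b1 b2 : bool, square_mod (powers 'i) Gauss
    ((u%:~R + 2 * 'i) * ((c%:~R + d%:~R * 'i) * (p1%:R ^+ b1 * p2%:R ^+ b2))).
Proof.
move=> pp1 pp2 cdE uvE; pose A := u * c - 2 * d; pose B := u * d + 2 * c.
pose P := (p1 * p2)%N%:Z; rewrite -/P in cdE uvE.
have sG : is_subfield Gauss by apply: Qadjoin_subfield.
have Gi : Gauss 'i by apply: Qadjoin_gen.
have sT : mul_subgroup (square_mod (powers 'i) Gauss).
  by apply: square_mod_subgroup => //; apply: powers_i_subgroup.
have P_gt0 : 0 < P by rewrite ltz_nat muln_gt0 !prime_gt0.
have vN0 : v != 0.
  by apply: contraPneq uvE => ->; rewrite expr0n mulr0; have := sqr_ge0 u; lia.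
have [|||G [GA _ GB zG]] := @square_mod_quad_norm _ 'i (-1) A B (P * v) sG Gi.
- by rewrite sqrCi mulrN1z.
- transitivity ((u ^+ 2 + 4) * (c ^+ 2 + d ^+ 2)); first by rewrite /A /B; ring.
  by rewrite uvE cdE; ring.
- by rewrite mulf_neq0 // gt_eqF.
have G4P : (G %| 4 * p1 * p2)%N.
  have : (G%:Z %| d * (2 * -1 * A) - 2 * c * (-1 * B))%Z by apply: rpredB; apply: dvdz_mull.
  have -> : d * (2 * -1 * A) - 2 * c * (-1 * B) = 4 * P by rewrite -cdE /A /B; ring.
  by rewrite /P -PoszM dvdzE /= mulnA.
have [b2 [G' [G'4 GE]]] := dvdn_mul_prime_split pp2 G4P.
have [b1 [G0 [G04 G'E]]] := dvdn_mul_prime_split pp1 G'4.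
have [k _ G0E] := dvdn_pfactor G0 2 (isT : prime 2) G04.
have zE : (u%:~R + 2 * 'i) * (c%:~R + d%:~R * 'i) = A%:~R + B%:~R * 'i :> algC.
  transitivity (u%:~R * c%:~R + 2 * d%:~R * 'i ^+ 2
                + (u%:~R * d%:~R + 2 * c%:~R) * 'i : algC); first by ring.
  by rewrite sqrCi /A /B !(rmorphB, rmorphD, rmorphM) /=; ring.
exists b1, b2; rewrite mulrA zE; apply: (mul_subgroup_cancel sT (u := 2 ^+ k.+1)).
  have -> : 2 ^+ k.+1 * ((A%:~R + B%:~R * 'i) * (p1%:R ^+ b1 * p2%:R ^+ b2)) =
      (A%:~R + B%:~R * 'i) * (2 * G%:R) :> algC.
    by rewrite GE G'E G0E !natrM !natrX exprS; ring.
  exact: (square_mod_sub powersN1_i (@subset_refl _ _) zG).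
by apply: (mul_subgroupX sT); apply: square_mod_2 => //; apply: powersX.
Qed.

Lemma quad_normN1_trace (m : nat) (nu : {rmorphism algC -> algC}) z :
    squarefree m -> nu (sqrtC m%:R) = - sqrtC m%:R -> z \in Aint ->
    has_quad_norm m z (-1) ->
  exists u v : int, z + nu z = u%:~R /\ u ^+ 2 + 4 = m%:Z * v ^+ 2.
Proof.
move=> sfm num Az [a [b [zE abE]]]; have [aQ bQ] := (Crat_rat a, Crat_rat b).
rewrite zE in Az *.
have [/intrP[u uE] /intrP[v vE]] := quad_coord_double_int num sfm aQ bQ Az.
exists u, v; split; first by rewrite (quad_conjE num) // -uE; ring.
apply: (@intr_inj algC); rewrite intrD [RHS]intrM !rmorphXn /= -uE -vE -pmulrn.
have := congr1 (ratr : rat -> algC) abE.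
rewrite rmorphN1 rmorphB [X in _ - X]rmorphM !rmorphXn /= ratr_nat => N1.
transitivity (4 * (ratr a ^+ 2 - -1) : algC); first by ring.
by rewrite N1; ring.
Qed.

(* As i^2 = N(eps), the product of eps and Tr(eps) + 2i is the square of eps + i. *)
Lemma fundamental_unit_square_class (p1 p2 : nat) (c d : int)
    (nu : {rmorphism algC -> algC}) (eps : algC) (F : set algC) :
    prime p1 -> prime p2 -> squarefree (p1 * p2) ->
    nu (sqrtC (p1 * p2)%:R) = - sqrtC (p1 * p2)%:R ->
    is_subfield F -> F 'i -> F (sqrtC (p1 * p2)%:R) ->
    F eps -> eps != 0 -> eps \in Aint -> has_quad_norm (p1 * p2) eps (-1) ->
    c ^+ 2 + d ^+ 2 = (p1 * p2)%N ->
  square_mod (powers 'i) F (eps * (c%:~R + d%:~R * 'i)) \/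
  square_mod (powers 'i) F (eps * ((c%:~R + d%:~R * 'i) * p2%:R)).
Proof.
move=> pp1 pp2 sfP nuP sF Fi FP Feps epsN0 Aeps eps_norm cdE.
have [u [v [trE uvE]]] := quad_normN1_trace sfP nuP Aeps eps_norm.
have sU := powers_i_subgroup.
have sT := square_mod_subgroup sU sF.
have uiN0 : u%:~R + 2 * 'i != 0 :> algC.
  apply/eqP => ui0; have : (u ^+ 2 + 4)%:~R = 0 :> algC.
    rewrite intrD rmorphXn /=; transitivity (u%:~R ^+ 2 - 4 * 'i ^+ 2 : algC).
      by rewrite sqrCi; ring.
    transitivity ((u%:~R + 2 * 'i) * (u%:~R - 2 * 'i) : algC); first by ring.
    by rewrite ui0 mul0r.
  by move/eqP; rewrite intr_eq0 => /eqP; have := sqr_ge0 u; lia.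
have eps_ui : square_mod (powers 'i) F (eps * (u%:~R + 2 * 'i)).
  rewrite -trE; apply: square_mod_norm; rewrite ?trE //.
  by rewrite (has_quad_norm_conj nuP eps_norm) sqrCi rmorphN1.
have [b1 [b2 ui_cd]] := Gauss_square_class pp1 pp2 cdE uvE.
have sub_F : Gauss `<=` F by apply: Qadjoin_min => // _ ->.
have Fui : F (u%:~R + 2 * 'i) by in_subfield.
move: ui_cd => /(square_mod_sub (@subset_refl _ _) sub_F).
move=> /(square_mod_trans sU sF Fui uiN0 eps_ui); set y := _ + _ * 'i => epsy.
have natN0 (p : nat) : prime p -> p%:R != 0 :> algC.
  by move=> pp; rewrite pnatr_eq0 -lt0n prime_gt0.
have p12_sqr : square_mod (powers 'i) F (p1%:R * p2%:R).
  rewrite -natrM -[(p1 * p2)%:R]sqrtCK; apply: square_mod_sqr => //.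
  by rewrite sqrtC_eq0 natrM mulf_neq0 ?natN0.
have Fp1 : F p1%:R by in_subfield.
case: b1 b2 epsy => -[]; rewrite ?expr0 ?expr1 ?mulr1 ?mul1r => epsy.
- by left; apply: (mul_subgroup_cancel sT) p12_sqr; rewrite mulrC -mulrA.
- right; rewrite mulrA; rewrite mulrA in epsy.
  exact: (square_mod_trans sU sF Fp1 (natN0 _ pp1) epsy p12_sqr).
- by right.
- by left.
Qed.

Lemma square_pm1_square_mod (d : nat) (x y c : int) (F : set algC) :
    is_subfield F -> F 'i -> F (sqrtC d%:R) -> (0 < d)%N ->
    x ^+ 2 - d%:Z * y ^+ 2 = 1 -> y != 0 -> is_unit F (x%:~R + y%:~R * sqrtC d%:R) ->
    c != 0 -> is_square_pm1 c x \/ is_square_pm1 (2 * c) x ->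
  square_mod (is_unit F) F c%:~R.
Proof.
move=> sF Fi Fd d_gt0 xy1 yN0 uU cN0 pm1.
set s := sqrtC _ in Fd uU; set u := x%:~R + _ in uU.
have sU := is_unit_subgroup sF; have sT := square_mod_subgroup sU sF.
have T2 : square_mod (is_unit F) F 2.
  by apply: square_mod_2 => //; apply: (mul_subgroupX sU); apply: is_unit_i.
have [n [sgn [nE sgn2]]] : exists (n : nat) (sgn : int),
    (c * (x + sgn) = n%:Z ^+ 2 \/ 2 * c * (x + sgn) = n%:Z ^+ 2) /\ sgn ^+ 2 = 1.
  case: pm1 => -[n [] nE]; exists n.
  - by exists 1; split; [left | rewrite expr1n].
  - by exists (-1); split; [left | rewrite sqrrN expr1n].
  - by exists 1; split; [right | rewrite expr1n].
  - by exists (-1); split; [right | rewrite sqrrN expr1n].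
have xsN0 : x + sgn != 0.
  apply: contraNneq yN0 => /eqP; rewrite addr_eq0 => /eqP xE; move/eqP: xy1.
  rewrite xE sqrrN sgn2 subr_eq addrC -subr_eq subrr eq_sym.
  by rewrite mulf_eq0 sqrf_eq0 eqz_nat (gtn_eqF d_gt0).
have Txs : square_mod (is_unit F) F (x + sgn)%:~R.
  apply: (mul_subgroup_cancel sT _ T2).
  apply: (mul_subgroup_cancel sT) (square_mod_unit _ uU) => //.
  pose u' : algC := x%:~R - y%:~R * s.
  have -> : 2 * (x + sgn)%:~R = u + u' + 2 * sgn%:~R by rewrite intrD /u /u'; ring.
  apply: square_mod_norm => //; [by case: uU => -[] | by in_subfield | by case: uU | |].
    have -> : u + u' + 2 * sgn%:~R = 2 * (x + sgn)%:~R by rewrite intrD /u /u'; ring.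
    by rewrite mulf_neq0 ?pnatr_eq0 ?intr_eq0.
  rewrite -rmorphXn /= sgn2 -xy1 rmorphB /= [X in _ = _ - X]intrM !rmorphXn /= -pmulrn.
  by rewrite -[d%:R]sqrtCK -/s /u /u'; ring.
have Tn : square_mod (is_unit F) F ((n%:R : algC) ^+ 2).
  apply: square_mod_sqr => //; first by in_subfield.
  rewrite pnatr_eq0; apply: contraPneq nE => ->; rewrite expr0n.
  by case=> /eqP; rewrite !mulf_eq0 (negPf cN0) (negPf xsN0).
apply: (mul_subgroup_cancel sT _ Txs); case: nE => nE.
  by rewrite mulrC -intrM nE rmorphXn.
apply: (mul_subgroup_cancel sT _ T2); rewrite [_ * c%:~R]mulrC mulrA.
by rewrite -[2]/(2%:~R) -!intrM nE rmorphXn.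
Qed.

(** * The capitulation kernel *)

Lemma Qadjoin_i_sqrtE s : Qadjoin [set s; 'i] = adjoin Gauss [set s].
Proof. by rewrite /Gauss /Qadjoin adjoin_adjoin setUC. Qed.

Lemma octicE (q P : nat) : (0 < q)%N ->
  adjoin (Qadjoin [set sqrtC (P * q)%:R; 'i]) [set sqrtC q%:R] =
  Qadjoin [set 'i; sqrtC q%:R; sqrtC P%:R].
Proof.
move=> q_gt0; rewrite /Qadjoin adjoin_adjoin sqrtC_natM.
have qN0 : sqrtC q%:R != 0 :> algC by rewrite sqrtC_eq0 pnatr_eq0 -lt0n.
apply/seteqP; split; apply: Qadjoin_min; try exact: adjoin_subfield.
  have sK := Qadjoin_subfield [set 'i; sqrtC q%:R; sqrtC P%:R : algC].
  move=> _ [[->|->]|->]; in_subfield; apply: Qadjoin_gen.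
  - by right.
  - by left; right.
  - by left; left.
  - by left; right.
set S := (X in adjoin _ X); have sK := Qadjoin_subfield S.
have Kq : Qadjoin S (sqrtC q%:R) by apply: Qadjoin_gen; right.
have KPq : Qadjoin S (sqrtC P%:R * sqrtC q%:R) by apply: Qadjoin_gen; left; left.
move=> _ [[->|->]|->] //; first by apply: Qadjoin_gen; left; right.
by rewrite -[sqrtC P%:R](mulfK qN0); in_subfield.
Qed.

Lemma Gauss_prime_ideal_sqrt (p m c : nat) (pi pi' : algC) (H : set algC)
    (nu : {rmorphism algC -> algC}) :
    nu 'i = 'i -> nu (sqrtC (p * m)%:R) = - sqrtC (p * m)%:R -> (0 < p)%N ->
    coprime p m -> coprime p c -> ringint Gauss pi -> ringint Gauss pi' ->
    pi * pi' = p%:R -> pi + pi' = c%:R ->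
    prime_above Gauss (Qadjoin [set sqrtC (p * m)%:R; 'i]) pi H ->
  ideal_sqrt (Qadjoin [set sqrtC (p * m)%:R; 'i]) pi H.
Proof.
rewrite Qadjoin_i_sqrtE => nui nus p_gt0 co_pm co_pc Opi Opi' piE trE.
have sG : is_subfield Gauss by apply: Qadjoin_subfield.
have piN0 : pi != 0.
  apply: contraTneq p_gt0 => pi0; move/eqP: piE.
  by rewrite pi0 mul0r eq_sym pnatr_eq0 lt0n => ->.
apply: (ramified_prime_ideal_sqrt (rho := pi' * m%:R) (sg := nu)) => //.
- by apply: adjoin_rmorph_id => // _ ->.
- by in_ringint.
- apply: (coprime_inMr sG Opi Opi').
    have [x [y [Ox Oy]]] := coprime_in_nat sG co_pc; rewrite -piE -trE => xyE.
    exists (x * pi' + y), y; split=> //; first by in_ringint.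
    by rewrite -[RHS]xyE; ring.
  have [x [y [Ox Oy]]] := coprime_in_nat sG co_pm; rewrite -piE => xyE.
  exists (x * pi'), y; split=> //; first by in_ringint.
  by rewrite -[RHS]xyE; ring.
- by rewrite sqrtCK natrM -piE; ring.
Qed.

Section SqrtClasses.

Variables (F : set algC) (G : set (set (set algC))).
Hypotheses (sF : is_subfield F) (sG : is_Cl_subgroup F G).

Definition has_sqrt_class_in (a : algC) : Prop :=
  exists2 I, ideal_sqrt F a I & G (ideal_class F I).

Lemma has_sqrt_class_in1 : has_sqrt_class_in 1.
Proof. by exists (ringint F); [apply: ideal_sqrt1 | case: sG]. Qed.

Lemma has_sqrt_class_inM a b :
  has_sqrt_class_in a -> has_sqrt_class_in b -> has_sqrt_class_in (a * b).
Proof.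
move=> [I aI GI] [J bJ GJ]; exists (idealM I J); first exact: ideal_sqrtM.
rewrite -(classM_ideal_class sF (ideal_sqrt_nzideal sF aI) (ideal_sqrt_nzideal sF bJ)).
by case: sG => _ _ GM _; apply: GM.
Qed.

Lemma has_sqrt_class_inX a n : has_sqrt_class_in a -> has_sqrt_class_in (a ^+ n).
Proof.
move=> Ga; elim: n => [|n IHn]; first exact: has_sqrt_class_in1.
by rewrite exprS; apply: has_sqrt_class_inM.
Qed.

Lemma has_sqrt_class_in_class a b I : has_sqrt_class_in a -> ideal_sqrt F b I ->
  square_mod (is_unit F) F (a * b) -> G (ideal_class F I).
Proof. by move=> [J aJ GJ] bI ab; rewrite -(ideal_sqrt_class sF aJ bI ab). Qed.

End SqrtClasses.

Section OcticCapitulation.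

Variables (q P : nat) (eps A : algC).
Let k : set algC := Qadjoin [set sqrtC (P * q)%:R; 'i].
Let K : set algC := adjoin k [set sqrtC q%:R].
Hypotheses (pq : prime q) (q3 : (q %% 4 = 3)%N) (P_gt1 : (1 < P)%N).
Hypothesis sf : squarefree (2 * (P * q)).
Hypotheses (eps_fund : is_fundamental_unit P eps) (eps_norm : has_quad_norm P eps (-1)).
Hypotheses (kA : k A) (AN0 : A != 0) (epsA : square_mod (powers 'i) K (eps * A)).

Let sk : is_subfield k. Proof. exact: Qadjoin_subfield. Qed.
Let sK : is_subfield K. Proof. exact: adjoin_subfield. Qed.
Let kK : k `<=` K. Proof. exact: sub_adjoin. Qed.
Let KE : K = Qadjoin [set 'i; sqrtC q%:R; sqrtC P%:R].
Proof. by rewrite /K octicE ?prime_gt0. Qed.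
Let powers_i_unit : powers 'i `<=` is_unit k.
Proof.
apply: powers_sub; first exact: is_unit_subgroup.
by apply: is_unit_i => //; apply: Qadjoin_gen; right.
Qed.
Let sqrt_natN0 (n : nat) : (0 < n)%N -> sqrtC n%:R != 0 :> algC.
Proof. by rewrite sqrtC_eq0 pnatr_eq0 -lt0n. Qed.

Lemma octic_radicand_square_mod : square_mod (is_unit K) K P%:R.
Proof.
rewrite -[P%:R]sqrtCK; apply: square_mod_sqr; first exact: is_unit_subgroup.
  by rewrite KE; apply: Qadjoin_gen; right.
exact: sqrt_natN0 (ltnW P_gt1).
Qed.

Lemma octic_square_class_square_mod : square_mod (is_unit K) K A.
Proof.
have sT := square_mod_subgroup (is_unit_subgroup sK) sK.
apply: (mul_subgroup_cancel sT (u := eps)).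
  have powers_i_unitK := subset_trans powers_i_unit (is_unit_sub kK).
  exact: (square_mod_sub powers_i_unitK (@subset_refl _ _) epsA).
by apply: square_mod_unit => //; rewrite KE; apply: fundamental_unit_octic.
Qed.

(* A unit of K of relative norm 1 is A^n up to units of k and squares of K, and P q is
   a square in k. *)
Lemma capitulation_octic_class I : is_nzideal k I -> capitulation k K (ideal_class k I) ->
  exists c n (b : bool), ideal_sqrt k c I /\
    square_mod (is_unit k) k (c * (A ^+ n * P%:R ^+ b)).
Proof.
move=> nzI capI; have q_gt1 := prime_gt1 pq; have kd : k (sqrtC (P * q)%:R).
  by apply: Qadjoin_gen; left.
have sfPq : squarefree (P * q) by apply: squarefree_dvd sf; rewrite dvdn_mull.
have [tau2 [tau2i tau2P tau2q]] := exists_aut_sqrtC sfPq P_gt1 q_gt1.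
rewrite mulnC in sfPq; have [tau1 [tau1i tau1q tau1P]] := exists_aut_sqrtC sfPq q_gt1 P_gt1.
pose sg : {rmorphism algC -> algC} := (tau1 \o tau2)%FUN.
have sgq : sg (sqrtC q%:R) = - sqrtC q%:R by rewrite /= tau2q rmorphN tau1q.
have fix_k z : k z -> sg z = z.
  apply: adjoin_rmorph_id => // _ [->|->] /=; last by rewrite tau2i tau1i.
  by rewrite sqrtC_natM !rmorphM tau2P tau2q tau1P rmorphN tau1q mulrNN.
have unitK eta : is_unit K eta -> eta * sg eta = 1 ->
    exists n, square_mod (is_unit k) K (eta * A ^+ n).
  move=> etaU etaN; have sU := powers_i_subgroup.
  have [n eta_eps] : exists n, square_mod (powers 'i) K (eta * eps ^+ n).
    rewrite KE in etaU *.
    exact: (octic_unit_class tau1i tau1q tau1P tau2i tau2P tau2q _ pq q3 (ltnW P_gt1) sf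
      eps_fund eps_norm etaU etaN).
  have [[Keps _] epsN0 _] := fundamental_unit_octic q eps_fund; rewrite -KE in Keps.
  exists n; apply: (square_mod_sub powers_i_unit (@subset_refl _ _)).
  apply: (square_mod_trans sU sK (subfieldX sK n Keps) _ eta_eps); first exact: expf_neq0.
  by rewrite -exprMn; apply: (mul_subgroupX (square_mod_subgroup sU sK)).
have kq : k (sqrtC q%:R ^+ 2) by rewrite sqrtCK; in_subfield.
have [c [n [b [cI cAq]]]] :=
  capitulation_sqrt_class sk kq (sqrt_natN0 (ltnW q_gt1)) fix_k sgq kA AN0 unitK nzI capI.
exists c, n, b; split=> //; rewrite mulrA; have sU := is_unit_subgroup sk.
apply: (square_mod_trans sU sk _ _ cAq); first by in_subfield.
  by rewrite !expf_neq0 // (sqrt_natN0 (ltnW q_gt1)).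
rewrite -exprMn; apply: (mul_subgroupX (square_mod_subgroup sU sk)).
rewrite sqrtCK -natrM mulnC -[(P * q)%:R]sqrtCK; apply: square_mod_sqr => //.
by apply: sqrt_natN0; rewrite muln_gt0 (ltnW P_gt1) (ltnW q_gt1).
Qed.

Lemma capitulation_octic (A' : algC) (I J : set algC) :
    ideal_sqrt k A I -> ideal_sqrt k A' J -> A * A' = P%:R ->
  capitulation k K = Cl_gen k [set ideal_class k I; ideal_class k J].
Proof.
move=> AI AJ AAE; have nzI := ideal_sqrt_nzideal sk AI.
have nzJ := ideal_sqrt_nzideal sk AJ.
have KA := octic_square_class_square_mod.
have KA' : square_mod (is_unit K) K A'.
  apply: (mul_subgroup_cancel (square_mod_subgroup (is_unit_subgroup sK) sK) _ KA).
  by rewrite AAE; apply: octic_radicand_square_mod.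
set S := [set _; _]; have SCl : S `<=` Cl k by move=> _ [->|->]; [exists I | exists J].
have sG := Cl_gen_subgroup sk SCl.
apply/seteqP; split=> [C capC|]; last first.
  apply: Cl_gen_min; first exact: capitulation_subgroup.
  by move=> _ [->|->]; [apply: capitulation_sqrt KA | apply: capitulation_sqrt KA'].
have [[L nzL CE] _] := capC; rewrite {}CE in capC *.
have [c [n [b [cL cAP]]]] := capitulation_octic_class nzL capC.
apply: (has_sqrt_class_in_class sk (a := A ^+ n * P%:R ^+ b) _ cL); last by rewrite mulrC.
have GA : has_sqrt_class_in k (Cl_gen k S) A by exists I => //; apply: sub_Cl_gen; left.
have GA' : has_sqrt_class_in k (Cl_gen k S) A' by exists J => //; apply: sub_Cl_gen; right.
rewrite -AAE; apply: (has_sqrt_class_inM sk sG); apply: (has_sqrt_class_inX sk sG) => //.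
exact: has_sqrt_class_inM.
Qed.

End OcticCapitulation.

Lemma Gauss_normE (e f : nat) :
  (e%:R + 2 * 'i * f%:R) * (e%:R - 2 * 'i * f%:R) = (e ^ 2 + 4 * f ^ 2)%:R :> algC.
Proof.
rewrite natrD natrM !natrX.
transitivity (e%:R ^+ 2 - 4 * f%:R ^+ 2 * 'i ^+ 2 : algC); first by ring.
by rewrite sqrCi; ring.
Qed.

Lemma sum_sqr_coprime (p e f : nat) : prime p -> odd p -> p = (e ^ 2 + 4 * f ^ 2)%N ->
  coprime p (2 * e).
Proof.
move=> pp odd_p pE; rewrite coprimeMr coprimen2 odd_p prime_coprime //=.
apply/negP => pe; have [e0|/dvdn_leq/(_ pe)] := posnP e.
  by move: odd_p; rewrite pE e0 exp0n // add0n oddM.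
by have := prime_gt1 pp; nia.
Qed.

Lemma prime_above_ideal_sqrt (p d e f : nat) (pi : algC) (H : set algC) :
    prime p -> odd p -> (p %| d)%N -> squarefree d -> p = (e ^ 2 + 4 * f ^ 2)%N ->
    pi = e%:R + 2 * 'i * f%:R \/ pi = e%:R - 2 * 'i * f%:R ->
    prime_above Gauss (Qadjoin [set sqrtC d%:R; 'i]) pi H ->
  ideal_sqrt (Qadjoin [set sqrtC d%:R; 'i]) pi H.
Proof.
move=> pp odd_p /dvdnP[m ->]; rewrite mulnC => sfd pE piE HP.
have sG : is_subfield Gauss by apply: Qadjoin_subfield.
have m_gt0 : (0 < m)%N by have := squarefree_gt0 sfd; rewrite muln_gt0 => /andP[].
have co_pm : coprime p m.
  rewrite prime_coprime //; apply: contra (sfd p pp) => pm.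
  by rewrite -mulnn dvdn_pmul2l // prime_gt0.
have [|nu [nui nus]] := @exists_aut_opp [:: 'i] _ (sqr_sqrtC_Crat (p * m)).
  rewrite (_ : [set` _] = [set 'i]); last first.
    by apply/seteqP; split=> z; rewrite /= inE => /eqP.
  move=> Gd; apply: (Gauss_sqr_neq sfd _ Gd); last by rewrite sqrtCK.
  by rewrite (leq_trans (prime_gt1 pp)) ?leq_pmulr.
have nui' : nu 'i = 'i by apply: nui; rewrite inE.
have Oi : ringint Gauss 'i by split; [apply: Qadjoin_gen | apply: Aint_i].
have co_pe := sum_sqr_coprime pp odd_p pE; have piN := Gauss_normE e f; rewrite -pE in piN.
case: piE HP => -> HP; [|rewrite mulrC in piN];
  apply: (Gauss_prime_ideal_sqrt nui' nus (prime_gt0 pp) co_pm co_pe _ _ piN _ HP);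
  by [in_ringint | rewrite natrM; ring].
Qed.

(* pi1 pi3 is a Gaussian integer of norm p1 p2, and (pi1 pi3) p2 = (pi1 pi4) pi3^2. *)
Lemma capitulation_prime_pairs (p1 p2 q e f g h : nat) (eps : algC)
    (k := Qadjoin [set sqrtC (p1 * p2 * q)%:R; 'i]) (H1 H2 H3 H4 : set algC) :
    prime p1 -> prime p2 -> prime q -> (q %% 4 = 3)%N ->
    squarefree (2 * (p1 * p2 * q)) ->
    is_fundamental_unit (p1 * p2) eps -> has_quad_norm (p1 * p2) eps (-1) ->
    p1 = (e ^ 2 + 4 * f ^ 2)%N -> p2 = (g ^ 2 + 4 * h ^ 2)%N ->
    ideal_sqrt k (e%:R + 2 * 'i * f%:R) H1 -> ideal_sqrt k (e%:R - 2 * 'i * f%:R) H2 ->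
    ideal_sqrt k (g%:R + 2 * 'i * h%:R) H3 -> ideal_sqrt k (g%:R - 2 * 'i * h%:R) H4 ->
  let K := adjoin k [set sqrtC q%:R] in
  capitulation k K =
    Cl_gen k [set ideal_class k (idealM H1 H3); ideal_class k (idealM H2 H4)] \/
  capitulation k K =
    Cl_gen k [set ideal_class k (idealM H1 H4); ideal_class k (idealM H2 H3)].
Proof.
move=> pp1 pp2 pq q3 sf eps_fund eps_norm p1E p2E S1 S2 S3 S4 K.
have N1 := Gauss_normE e f; rewrite -p1E in N1.
have N2 := Gauss_normE g h; rewrite -p2E in N2.
move: S1 S2 S3 S4 N1 N2.
set pi1 := _ + _; set pi2 := _ - _; set pi3 := _ + _; set pi4 := _ - _.
move=> S1 S2 S3 S4 N1 N2.
have [[p1_gt1 p2_gt1] q_gt1] := (prime_gt1 pp1, prime_gt1 pp2, prime_gt1 pq).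
have P_gt1 : (1 < p1 * p2)%N by apply: (@ltn_mul 1 1).
have sfqP : squarefree (q * (p1 * p2)) by apply: squarefree_dvd sf; rewrite mulnC dvdn_mull.
have sfP : squarefree (p1 * p2) by apply: squarefree_dvd sfqP; rewrite dvdn_mull.
have [nu [_ _ nuP]] := exists_aut_sqrtC sfqP q_gt1 P_gt1.
have sk : is_subfield k by apply: Qadjoin_subfield.
have sK : is_subfield K by apply: adjoin_subfield.
have KE : K = Qadjoin [set 'i; sqrtC q%:R; sqrtC (p1 * p2)%:R].
  by apply: octicE; apply: ltnW.
have [[Keps Aeps] epsN0 _] := fundamental_unit_octic q eps_fund; rewrite -KE in Keps.
have KP : K (sqrtC (p1 * p2)%:R) by rewrite KE; apply: Qadjoin_gen; right.
have Ki : K 'i by rewrite KE; apply: Qadjoin_gen; left; left.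
pose c : int := e%:Z * g%:Z - 4 * (f%:Z * h%:Z).
pose d : int := 2 * (e%:Z * h%:Z + f%:Z * g%:Z).
have cdE : c ^+ 2 + d ^+ 2 = (p1 * p2)%N.
  by rewrite /c /d p1E p2E; lia.
have pi13 : c%:~R + d%:~R * 'i = pi1 * pi3.
  rewrite /c /d !(rmorphB, rmorphD, rmorphM) /= -!pmulrn /pi1 /pi3.
  transitivity (e%:R * g%:R + 4 * (f%:R * h%:R) * 'i ^+ 2
                + 2 * (e%:R * h%:R + f%:R * g%:R) * 'i : algC).
    by rewrite sqrCi; ring.
  by ring.
have cap := capitulation_octic pq q3 P_gt1 sf eps_fund eps_norm.
have := fundamental_unit_square_class
  pp1 pp2 sfP nuP sK Ki KP Keps epsN0 Aeps eps_norm cdE.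
rewrite pi13; case=> epsA; [left | right].
  have [_ [kA _] AN0 _] := ideal_sqrtM sk S1 S3.
  apply: (cap _ kA AN0 epsA _ _ _ (ideal_sqrtM sk S1 S3) (ideal_sqrtM sk S2 S4)).
  by rewrite mulrACA N1 N2 natrM.
have [_ [kA _] AN0 _] := ideal_sqrtM sk S1 S4.
apply: (cap _ kA AN0 _ _ _ _ (ideal_sqrtM sk S1 S4) (ideal_sqrtM sk S2 S3)).
  have [_ [k3 _] pi3N0 _] := S3; have sU := powers_i_subgroup.
  apply: (mul_subgroup_cancel (square_mod_subgroup sU sK) (u := pi3 ^+ 2)); last first.
    by apply: square_mod_sqr => //; apply: sub_adjoin.
  by move: epsA; rewrite -N2; congr square_mod; ring.
by rewrite mulrACA N1 [pi4 * _]mulrC N2 natrM.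
Qed.

Lemma fundamental_unit_coord (m : nat) (x y : int) : squarefree m -> (m %% 4 = 3)%N ->
  is_fundamental_unit m (x%:~R + y%:~R * sqrtC m%:R) ->
  x ^+ 2 - m%:Z * y ^+ 2 = 1 /\ y != 0.
Proof.
move=> sfm m3 [uU u_gt1 _]; have m_gt1 : (1 < m)%N by lia.
have [|nu [_ nus]] := @exists_aut_opp [::] _ (sqr_sqrtC_Crat m).
  move=> Qs; apply: (Crat_sqr_neq sfm m_gt1 (z := sqrtC m%:R)); last by rewrite sqrtCK.
  by apply: (Qadjoin_min Crat_subfield) Qs.
have xy1 := quad_unit_coord nus m3 uU; split=> //.
apply/eqP => y0; move: xy1 u_gt1; rewrite y0 expr0n mulr0 subr0 mul0r addr0 => /eqP.
rewrite sqrf_eq1 => /orP[]/eqP->; rewrite ?ltxx // mulrN1z => lt1.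
by have := lt_trans lt1 (ltrN10 _); rewrite ltr10.
Qed.

Lemma fundamental_unit_pm1_square_mod (d p : nat) (x y : int)
    (k := Qadjoin [set sqrtC d%:R; 'i]) :
    squarefree d -> (d %% 4 = 3)%N ->
    is_fundamental_unit d (x%:~R + y%:~R * sqrtC d%:R) -> (0 < p)%N ->
    is_square_pm1 p x \/ is_square_pm1 (2 * p%:Z) x ->
  square_mod (is_unit k) k p%:R.
Proof.
move=> sfd d3 eps_fund p_gt0; have [xy1 yN0] := fundamental_unit_coord sfd d3 eps_fund.
have sk : is_subfield k by apply: Qadjoin_subfield.
have kd : k (sqrtC d%:R) by apply: Qadjoin_gen; left.
have ki : k 'i by apply: Qadjoin_gen; right.
apply: (square_pm1_square_mod sk ki kd (squarefree_gt0 sfd) xy1 yN0);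
  last by rewrite eqz_nat -lt0n.
by case: eps_fund => uU _ _; apply: is_unit_sub uU; apply: Qadjoin_min => // _ ->.
Qed.

Lemma square_mod_sqrtC_cofactor (m n : nat) (k := Qadjoin [set sqrtC (m * n)%:R; 'i]) :
  (0 < m * n)%N -> square_mod (is_unit k) k n%:R -> square_mod (is_unit k) k m%:R.
Proof.
move=> mn_gt0; have sk : is_subfield k by apply: Qadjoin_subfield.
have sU := is_unit_subgroup sk; apply: (mul_subgroup_cancel (square_mod_subgroup sU sk)).
rewrite mulrC -natrM -[(m * n)%:R]sqrtCK; apply: square_mod_sqr => //.
  by apply: Qadjoin_gen; left.
by rewrite sqrtC_eq0 pnatr_eq0 -lt0n.
Qed.

Lemma squarefree_double_mul3 (p1 p2 q : nat) : prime p1 -> prime p2 -> prime q ->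
  uniq [:: p1; p2; q] -> odd p1 -> odd p2 -> odd q -> squarefree (2 * (p1 * p2 * q)).
Proof.
move=> pp1 pp2 pq uniq_pq odd1 odd2 oddq.
have := @squarefree_prod [:: 2%N; p1; p2; q].
rewrite !big_cons big_nil muln1 /= pp1 pp2 pq !mulnA.
by apply=> //; move: uniq_pq; rewrite /= => ->; rewrite andbT !inE; lia.
Qed.

Lemma idealM_class_pairs (F : set algC) (a1 a2 a3 a4 : algC) (I1 I2 I3 I4 : set algC)
    (cl := fun I J => ideal_class F (idealM I J)) :
    is_subfield F -> ideal_sqrt F a1 I1 -> ideal_sqrt F a2 I2 ->
    ideal_sqrt F a3 I3 -> ideal_sqrt F a4 I4 ->
  [/\ square_mod (is_unit F) F (a1 * a2 * (a3 * a4)) ->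
         cl I1 I3 = cl I2 I4 /\ cl I1 I4 = cl I2 I3,
      square_mod (is_unit F) F (a1 * a2) -> cl I1 I3 = cl I2 I3 /\ cl I1 I4 = cl I2 I4 &
      square_mod (is_unit F) F (a3 * a4) -> cl I1 I3 = cl I1 I4 /\ cl I2 I3 = cl I2 I4].
Proof.
move=> sF S1 S2 S3 S4; split=> [sqr_all|sqr12|sqr34]; rewrite /cl; split.
- apply: (ideal_sqrt_class sF (ideal_sqrtM sF S1 S3) (ideal_sqrtM sF S2 S4)).
  by rewrite mulrACA.
- apply: (ideal_sqrt_class sF (ideal_sqrtM sF S1 S4) (ideal_sqrtM sF S2 S3)).
  by rewrite mulrACA (mulrC a4).
- exact: ideal_sqrt_class_idealMl S1 S2 sqr12 _ _ S3.
- exact: ideal_sqrt_class_idealMl S1 S2 sqr12 _ _ S4.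
- by rewrite !(idealMC I1); apply: ideal_sqrt_class_idealMl S3 S4 sqr34 _ _ S1.
- by rewrite !(idealMC I2); apply: ideal_sqrt_class_idealMl S3 S4 sqr34 _ _ S2.
Qed.

Theorem theorem5p7
  (p1 p2 q : nat) (pp1 : prime p1) (pp2 : prime p2) (pq : prime q)
  (distinct : uniq [:: p1; p2; q])
  (p1mod4 : (p1%:Z = 1 %[mod 4])%Z)
  (p2mod4 : (p2%:Z = 1 %[mod 4])%Z)
  (qmod4 : (- q%:Z = 1 %[mod 4])%Z)
  (k : set algC) (kE : k = Qadjoin [set sqrtC (p1 * p2 * q)%:R; 'i])
  (K3 : set algC) (K3E : K3 = adjoin k [set sqrtC q%:R])
  (x y : int)
  (eps_p1p2q : is_fundamental_unit (p1 * p2 * q)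
                 (x%:~R + y%:~R * sqrtC (p1 * p2 * q)%:R))
  (eps : algC) (eps_p1p2 : is_fundamental_unit (p1 * p2) eps)
  (norm_eps : has_quad_norm (p1 * p2) eps (-1))
  (e f g h : nat)
  (p1E : p1 = (e ^ 2 + 4 * f ^ 2)%N) (p2E : p2 = (g ^ 2 + 4 * h ^ 2)%N)
  (H1 H2 H3 H4 : set algC)
  (H1P : prime_above (Qadjoin [set 'i]) k (e%:R + 2 * 'i * f%:R) H1)
  (H2P : prime_above (Qadjoin [set 'i]) k (e%:R - 2 * 'i * f%:R) H2)
  (H3P : prime_above (Qadjoin [set 'i]) k (g%:R + 2 * 'i * h%:R) H3)
  (H4P : prime_above (Qadjoin [set 'i]) k (g%:R - 2 * 'i * h%:R) H4) :
  [/\ (is_square_pm1 q%:Z x \/ is_square_pm1 (2 * q%:Z) x ->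
         capitulation k K3 = Cl_gen k [set ideal_class k (idealM H1 H3)] \/
         capitulation k K3 = Cl_gen k [set ideal_class k (idealM H1 H4)]),
      (is_square_pm1 1 x ->
         capitulation k K3 =
           Cl_gen k [set ideal_class k (idealM H1 H3);
                         ideal_class k (idealM H2 H4)] \/
         capitulation k K3 =
           Cl_gen k [set ideal_class k (idealM H1 H4);
                         ideal_class k (idealM H2 H3)]),
      (is_square_pm1 p1%:Z x \/ is_square_pm1 (2 * p1%:Z) x ->
         capitulation k K3 =
           Cl_gen k [set ideal_class k (idealM H1 H3);
                         ideal_class k (idealM H1 H4)]) &
      (is_square_pm1 p2%:Z x \/ is_square_pm1 (2 * p2%:Z) x ->
         capitulation k K3 =
           Cl_gen k [set ideal_class k (idealM H1 H3);
                         ideal_class k (idealM H2 H3)])].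

Proof.
have [m1 m2 mq] : [/\ p1 %% 4 = 1, p2 %% 4 = 1 & q %% 4 = 3]%N by split; lia.
have md : (p1 * p2 * q %% 4 = 3)%N by rewrite -modnMm -(modnMm p1) m1 m2 mq.
have [odd1 odd2 oddq] : [/\ odd p1, odd p2 & odd q] by split; lia.
have sf := squarefree_double_mul3 pp1 pp2 pq distinct odd1 odd2 oddq.
have sfd : squarefree (p1 * p2 * q) by apply: squarefree_dvd sf; rewrite dvdn_mull.
subst k K3; have sk := Qadjoin_subfield [set sqrtC (p1 * p2 * q)%:R; 'i].
have d1 : (p1 %| p1 * p2 * q)%N by rewrite -mulnA dvdn_mulr.
have d2 : (p2 %| p1 * p2 * q)%N by rewrite mulnAC dvdn_mull.
have S1 := prime_above_ideal_sqrt pp1 odd1 d1 sfd p1E (or_introl erefl) H1P.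
have S2 := prime_above_ideal_sqrt pp1 odd1 d1 sfd p1E (or_intror erefl) H2P.
have S3 := prime_above_ideal_sqrt pp2 odd2 d2 sfd p2E (or_introl erefl) H3P.
have S4 := prime_above_ideal_sqrt pp2 odd2 d2 sfd p2E (or_intror erefl) H4P.
have capE := capitulation_prime_pairs
  pp1 pp2 pq mq sf eps_p1p2 norm_eps p1E p2E S1 S2 S3 S4.
have sqr_prime p pp :=
  @fundamental_unit_pm1_square_mod _ p x y sfd md eps_p1p2q (@prime_gt0 p pp).
have sqr_P := square_mod_sqrtC_cofactor (squarefree_gt0 sfd).
have [] := idealM_class_pairs sk S1 S2 S3 S4; rewrite !Gauss_normE -p1E -p2E -natrM.
move=> class_P class_p1 class_p2.
split=> [/(sqr_prime _ pq)/sqr_P/class_P[E13 E14]|//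
        |/(sqr_prime _ pp1)/class_p1[E13 E14]|/(sqr_prime _ pp2)/class_p2[E13 E23]].
- by case: capE => ->; [left; rewrite -E13 | right; rewrite -E14]; rewrite setUid.
- by case: capE => ->; rewrite -?E13 -?E14 //; congr Cl_gen; apply: setUC.
- by case: capE => ->; rewrite -?E13 -?E23.
Qed.
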